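(* Let $\Phi=(G,\varphi)$ be a complex unit gain graph of order $n$ with $r(\Phi)=r(G)+2\theta(G)$. Then (i) the cycles (if any) of $G$ are pairwise vertex-disjoint; (ii) each cycle $C_p^{\varphi}$ of $\Phi$ is of Type B with order $p\equiv 0\pmod 4$; (iii) $r(G)=r(T_G)+\sum_{O\in\mathcal{C}(G)}(|V(O)|-2)$ and $r(T_G)=r(\Gamma_G)$.
   Context: A complex unit gain graph $\Phi=(G,\varphi)$ consists of a finite simple graph $G$ with vertex set $\{v_1,\dots,v_n\}$ and a gain function $\varphi$ assigning to each oriented edge $e_{ij}$ ($v_iv_j\in E(G)$) a complex number of modulus $1$ with $\varphi(e_{ji})=\overline{\varphi(e_{ij})}$. $A(\Phi)$ is the Hermitian matrix with $(i,j)$ entry $\varphi(e_{ij})$ if $v_iv_j\in E(G)$ and $0$ otherwise; $r(\Phi)$ is its rank; $r(\cdot)$ of a simple graph is the rank of its $0$-$1$ adjacency matrix. $\theta(G)=|E(G)|-|V(G)|+\omega(G)$, $\omega(G)$ the number of components. For a gain cycle with vertices $v_1,\dots,v_p$ in cyclic order, $\varphi(C_p)=\varphi(e_{12})\cdots\varphi(e_{p1})$; for $p$ even it is of Type B if $\varphi(C_p)\neq(-1)^{p/2}$. For a graph $G$ whose cycles are pairwise vertex-disjoint, $\mathcal{C}(G)$ is its set of cycles, and $T_G$ is the acyclic graph obtained by contracting each cycle $O$ to a vertex $t_O$: its vertex set is $U\cup C_G$, where $U$ is the set of vertices of $G$ on no cycle and $C_G=\{t_O:O\in\mathcal{C}(G)\}$;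 $u_1,u_2\in U$ are adjacent iff $u_1u_2\in E(G)$; $u\in U$ is adjacent to $t_O$ iff $u$ is adjacent in $G$ to some vertex of $O$; $t_{O_1},t_{O_2}$ are adjacent iff some edge of $G$ joins a vertex of $O_1$ to a vertex of $O_2$. $\Gamma_G$ is obtained from $T_G$ by deleting the vertices of $C_G$ and their incident edges. *)

(* Defs.v *)
From HB Require Import structures.
From mathcomp Require Import all_boot all_order all_algebra.
From mathcomp Require Import boolp.
Set Implicit Arguments. Unset Strict Implicit. Unset Printing Implicit Defensive.
Import Order.TTheory GRing.Theory Num.Theory.
Local Open Scope ring_scope.

Definition simple_graph (n : nat) (adj : rel 'I_n) : Prop :=
  symmetric adj /\ irreflexive adj.

Definition unit_gain (C : numClosedFieldType) (n : nat) (adj : rel 'I_n)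
  (phi : 'I_n -> 'I_n -> C) : Prop :=
  forall i j, adj i j -> `|phi i j| = 1 /\ phi j i = (phi i j)^*.

Definition gain_adj_mx (C : numClosedFieldType) (n : nat) (adj : rel 'I_n)
  (phi : 'I_n -> 'I_n -> C) : 'M[C]_n :=
  \matrix_(i, j) (if adj i j then phi i j else 0).

Definition adj_mx (C : numClosedFieldType) (n : nat) (adj : rel 'I_n) : 'M[C]_n :=
  \matrix_(i, j) (adj i j)%:R.

Definition num_edges (n : nat) (adj : rel 'I_n) : nat :=
  #|[set p : 'I_n * 'I_n | adj p.1 p.2 && (p.1 < p.2)%N]|.

Definition num_comps (n : nat) (adj : rel 'I_n) : nat :=
  n_comp adj [pred _ : 'I_n | true].

(* theta(G) = |E| - |V| + omega  (always >= 0) *)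
Definition cyclomatic (n : nat) (adj : rel 'I_n) : nat :=
  (num_edges adj + num_comps adj - n)%N.

Definition is_cycle (n : nat) (adj : rel 'I_n) (c : seq 'I_n) : bool :=
  [&& (2 < size c)%N, uniq c & cycle adj c].

Definition cycle_edge (n : nat) (c : seq 'I_n) : rel 'I_n :=
  fun x y => (x \in c) && ((y == next c x) || (x == next c y)).

Definition cycle_gain (C : numClosedFieldType) (n : nat) (phi : 'I_n -> 'I_n -> C)
  (c : seq 'I_n) : C :=
  \prod_(x <- c) phi x (next c x).

Definition typeB (C : numClosedFieldType) (n : nat) (phi : 'I_n -> 'I_n -> C)
  (c : seq 'I_n) : bool :=
  ~~ odd (size c) && (cycle_gain phi c != (-1) ^+ (size c)./2).

Definition on_cycle (n : nat) (adj : rel 'I_n) (x : 'I_n) : bool :=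
  `[< exists c, is_cycle adj c /\ x \in c >].

(* x itself together with every vertex on a cycle through x; when the cycles
   are pairwise disjoint this is V(O) for x on the cycle O, and {x} for x in U *)
Definition cyc_class (n : nat) (adj : rel 'I_n) (x : 'I_n) : {set 'I_n} :=
  [set y | (y == x) || `[< exists c, [/\ is_cycle adj c, x \in c & y \in c] >]].

(* vertex set of T_G: U, plus one representative t_O (least vertex) per cycle O *)
Definition TG_verts (n : nat) (adj : rel 'I_n) : {set 'I_n} :=
  [set x | [forall y in cyc_class adj x, (x <= y)%N]].

Definition TG_adj (n : nat) (adj : rel 'I_n) : rel 'I_n :=
  fun x y => (x != y) &&
    [exists a in cyc_class adj x, exists b in cyc_class adj y, adj a b].

Definition TG_mx (C : numClosedFieldType) (n : nat) (adj : rel 'I_n)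
  : 'M[C]_#|TG_verts adj| :=
  \matrix_(i, j) (TG_adj adj (enum_val i) (enum_val j))%:R.

Definition U_verts (n : nat) (adj : rel 'I_n) : {set 'I_n} :=
  [set x | ~~ on_cycle adj x].

(* adjacency matrix of Gamma_G = T_G - C_G = induced subgraph of G on U *)
Definition GammaG_mx (C : numClosedFieldType) (n : nat) (adj : rel 'I_n)
  : 'M[C]_#|U_verts adj| :=
  \matrix_(i, j) (adj (enum_val i) (enum_val j))%:R.

Arguments adj_mx C {n} adj.
Arguments TG_mx C {n} adj.
Arguments GammaG_mx C {n} adj.

(* Main.v *)
(* Deleting a vertex lowers the rank of A(Phi) by at most 2 and never raises the
   rank of A(G), while deleting a vertex of a cycle lowers theta(G).  Induction
   down to forests, where switching gives r(Phi) = r(G), yields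
   r(Phi) <= r(G) + 2 theta(G).  In the extremal case every such step is tight:
   for x on a cycle, Phi - x is again extremal, r(G - x) = r(G), and theta drops
   by exactly 1, which gives (i).  Moreover r(G - x) = r(G) provides a vector z in
   the kernel of A(G) with z_x <> 0.

   Let xy be a bridge and B the component of y in G - xy.  Pairing kernel vectors
   over B gives z'_y z_x = z_y z'_x; if B is bipartite, twisting z by the
   2-colouring gives z_x z_y = 0.  Hence kernel vectors vanish at the neighbours
   of a cycle lying off that cycle, so they satisfy z_(i+2) = - z_i along the
   cycle, which forces its length to be divisible by 4.  If its gain were 1,
   deleting vertices until no other cycle is left would give a balanced extremal
   gain graph with theta = 1, which is absurd.

   For (iii), kernel vectors restricted to branches produce, for every neighbour y
   of a cycle, a vector w_y supported on U, vanishing at all neighbours of cycles,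
   with A(G) w_y = e_y.  The congruence by 1 + W L decouples the cycles from
   Gamma_G both in A(G) and in A(T_G). *)
Require Import Defs.
From HB Require Import structures.
From mathcomp Require Import all_boot all_order all_algebra.
From mathcomp Require Import boolp.
From mathcomp Require Import zify.
Set Implicit Arguments. Unset Strict Implicit. Unset Printing Implicit Defensive.
Import Order.TTheory GRing.Theory Num.Theory.
Local Open Scope ring_scope.

(** * Edge and vertex deletion, and the cyclomatic number *)

Definition del_edge (n : nat) (adj : rel 'I_n) (u v : 'I_n) : rel 'I_n :=
  fun x y => adj x y && ~~ (((x == u) && (y == v)) || ((x == v) && (y == u))).

(** Deleted vertices stay as isolated points, so the vertex type ['I_n] never changes; isolated
    points affect neither the ranks nor the cyclomatic number. *)
Definition del_verts (n : nat) (adj : rel 'I_n) (D : {set 'I_n}) : rel 'I_n :=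
  fun x y => [&& adj x y, x \notin D & y \notin D].

Lemma del_edgeC (n : nat) (adj : rel 'I_n) u v :
  del_edge adj u v =2 del_edge adj v u.
Proof. by move=> x y; rewrite /del_edge orbC. Qed.

Lemma del_edge_sub (n : nat) (adj : rel 'I_n) u v : subrel (del_edge adj u v) adj.
Proof. by move=> x y /andP[]. Qed.

Lemma del_edge_simple (n : nat) (adj : rel 'I_n) u v :
  simple_graph adj -> simple_graph (del_edge adj u v).
Proof.
case=> sA iA; split=> [x y|x]; last by rewrite /del_edge iA.
by rewrite /del_edge sA orbC [(y == u) && _]andbC [(y == v) && _]andbC.
Qed.

Lemma del_edgexx (n : nat) (adj : rel 'I_n) u v : del_edge adj u v u v = false.
Proof. by rewrite /del_edge !eqxx andbF. Qed.

Lemma del_edge_or (n : nat) (adj : rel 'I_n) u v x y :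
  adj x y -> [\/ del_edge adj u v x y, x = u /\ y = v | x = v /\ y = u].
Proof.
move=> axy; rewrite /del_edge axy /=.
case: (boolP ((x == u) && (y == v))) => [/andP[/eqP -> /eqP ->]|_].
  by constructor 2.
case: (boolP ((x == v) && (y == u))) => [/andP[/eqP -> /eqP ->]|_].
  by constructor 3.
by constructor 1.
Qed.

Lemma del_verts_sub (n : nat) (adj : rel 'I_n) D : subrel (del_verts adj D) adj.
Proof. by move=> x y /and3P[]. Qed.

Lemma del_verts_simple (n : nat) (adj : rel 'I_n) D :
  simple_graph adj -> simple_graph (del_verts adj D).
Proof.
case=> sA iA; split=> [x y|x]; last by rewrite /del_verts iA.
by rewrite /del_verts sA [(x \notin D) && _]andbC.
Qed.

Lemma eq_num_edges (n : nat) (adj adj' : rel 'I_n) :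
  adj =2 adj' -> num_edges adj = num_edges adj'.
Proof. by move=> e; apply: eq_card => p; rewrite !inE e. Qed.

Lemma eq_num_comps (n : nat) (adj adj' : rel 'I_n) :
  connect adj =2 connect adj' -> num_comps adj = num_comps adj'.
Proof. by move=> e; rewrite /num_comps (eq_n_comp e). Qed.

Lemma num_edges_del_edge (n : nat) (adj : rel 'I_n) u v :
  simple_graph adj -> adj u v ->
  num_edges adj = (num_edges (del_edge adj u v)).+1.
Proof.
move=> [sA iA]; wlog ltuv : u v / (u < v)%N => [hw|] auv.
  have /orP[] : (u < v)%N || (v < u)%N.
  - rewrite -neq_ltn; apply: contraTneq auv => /val_inj ->.
    by rewrite iA.
  - by move/hw; apply.
  - move/hw; rewrite sA => /(_ auv) ->; congr _.+1.
    by apply: eq_num_edges; apply: del_edgeC.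
rewrite /num_edges (cardsD1 (u, v)) inE /= auv ltuv add1n; congr _.+1.
apply: eq_card => -[a b]; rewrite !inE /del_edge /= xpair_eqE.
case: (boolP ((a == u) && (b == v))) => //= _; first by rewrite andbF.
case: (boolP ((a == v) && (b == u))) => //= [/andP[/eqP -> /eqP ->]|_].
  by rewrite ltnNge (ltnW ltuv) !andbF.
by rewrite andbT.
Qed.

Lemma connect_del_edge (n : nat) (adj : rel 'I_n) u v :
  simple_graph adj -> connect (del_edge adj u v) u v ->
  connect (del_edge adj u v) =2 connect adj.
Proof.
move=> gA cuv x y; have [sD _] := del_edge_simple u v gA.
apply/idP/idP; first by apply: connect_sub => a b /del_edge_sub; exact: connect1.
apply: connect_sub => a b /(@del_edge_or _ _ u v)[/connect1 //|[-> ->] //|[-> ->]].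
by rewrite (sym_connect_sym sD).
Qed.

(** Restoring the edge [uv] can merge only the components of [u] and [v]. Hence [fingraph.root adj]
    is injective on the roots of the smaller graph once the root of [v] is set aside. *)
Lemma num_comps_del_edge (n : nat) (adj : rel 'I_n) u v :
  simple_graph adj -> (num_comps (del_edge adj u v) <= (num_comps adj).+1)%N.
Proof.
move=> gA; set adj' := del_edge adj u v.
have sA := sym_connect_sym gA.1.
have sD : connect_sym adj' := sym_connect_sym (del_edge_simple u v gA).1.
(* Connectivity without the edge, with the components of [u] and [v] glued together. *)
pose E x y := connect adj' x y ||
  ((connect adj' u x || connect adj' v x) && (connect adj' u y || connect adj' v y)).
have adjE x y : connect adj x y -> E x y.
  move=> /connectP[p pth ->]; elim/last_ind: p pth => [|p z IH].
    by rewrite /E /= connect0.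
  rewrite rcons_path last_rcons => /andP[/IH{IH} Exl /(@del_edge_or _ _ u v)].
  rewrite /E; case=> [lz|[lu ->]|[lv ->]]; last 2 first.
  - rewrite connect0 orbT andbT; move: Exl; rewrite /E lu.
    by case/orP=> [|/andP[-> _]]; [rewrite (sD u) => ->|]; rewrite orbT.
  - rewrite connect0 andbT; move: Exl; rewrite /E lv.
    by case/orP=> [|/andP[-> _]]; [rewrite (sD v) => ->|]; rewrite !orbT.
  have cl w : connect adj' w (last x p) -> connect adj' w z.
    by move=> h; apply: connect_trans h (connect1 lz).
  move: Exl; rewrite /E => /orP[/cl -> //|/andP[-> /orP[/cl ->|/cl ->]]].
    by rewrite orbT.
  by rewrite !orbT.
rewrite /num_comps /n_comp_mem.
set R' := [predI roots adj' & _]; set R := [predI roots adj & _].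
have [rv|rv] := boolP (fingraph.root adj' v \in R'); last first.
  by case/negP: rv; rewrite !inE roots_root.
rewrite [leqLHS](cardD1 (fingraph.root adj' v)) rv add1n ltnS.
have inj : {in [predD1 R' & fingraph.root adj' v] &, injective (fingraph.root adj)}.
  have nv a : fingraph.root adj' a = a -> a != fingraph.root adj' v -> ~~ connect adj' v a.
    move=> ra; apply: contra => /(fingraph.rootP sD) ->; by rewrite ra.
  move=> a b; rewrite !inE !andbT => /andP[na /eqP ra] /andP[nb /eqP rb].
  move/(fingraph.rootP sA)/adjE.
  rewrite /E (negbTE (nv _ ra na)) (negbTE (nv _ rb nb)) !orbF.
  case/orP => [/(fingraph.rootP sD)|/andP[ca cb]]; first by rewrite ra rb.
  suff /(fingraph.rootP sD) : connect adj' a b by rewrite ra rb.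
  by apply: connect_trans cb; rewrite sD.
rewrite -(card_in_imset inj); apply: subset_leq_card.
by apply/subsetP => _ /imsetP[a _ ->]; rewrite !inE roots_root.
Qed.

(** Edges are removed one at a time: each removal lowers the edge count by exactly one and raises
    the component count by at most one. *)
Lemma edges_comps_sub (n : nat) (adj adj' : rel 'I_n) :
  simple_graph adj -> simple_graph adj' -> subrel adj' adj ->
  (num_edges adj' + num_comps adj' <= num_edges adj + num_comps adj)%N.
Proof.
move=> gA gA'; have [m] := ubnP (num_edges adj).
elim: m adj gA => [|m IH] adj gA lt_m sub; first by exfalso; rewrite ltn0 in lt_m.
have [/existsP[x /existsP[y /andP[axy axy']]]|] :=
  boolP [exists x, exists y, adj x y && ~~ adj' x y]; last first.
  rewrite negb_exists => /forallP noxy.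
  suff e : adj =2 adj' by rewrite (eq_num_edges e) (eq_num_comps (eq_connect e)).
  move=> x y; apply/idP/idP; last exact: sub.
  move=> axy; move: (noxy x); rewrite negb_exists => /forallP/(_ y).
  by rewrite axy negbK.
have nE := num_edges_del_edge gA axy.
have nC := num_comps_del_edge x y gA.
suff : (num_edges adj' + num_comps adj' <=
   num_edges (del_edge adj x y) + num_comps (del_edge adj x y))%N by lia.
apply: IH; first exact: del_edge_simple.
  by lia.
move=> a b a'; rewrite /del_edge sub //=; apply/negP => /orP[] /andP[/eqP ea /eqP eb].
  by move: axy'; rewrite -ea -eb a'.
by move: axy'; rewrite -ea -eb gA'.1 a'.
Qed.

(** Comparison with the edgeless graph, which has [n] components. This makes the truncated
    subtraction in [cyclomatic] exact. *)
Lemma edges_comps_ge (n : nat) (adj : rel 'I_n) :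
  simple_graph adj -> (n <= num_edges adj + num_comps adj)%N.
Proof.
move=> gA; pose adj0 : rel 'I_n := fun _ _ => false.
have g0 : simple_graph adj0 by [].
have s0 : subrel adj0 adj by [].
have := edges_comps_sub gA g0 s0.
have -> : num_edges adj0 = 0%N by apply/eqP; rewrite cards_eq0; apply/eqP/setP=> p; rewrite !inE.
have -> : num_comps adj0 = n; last by [].
rewrite -[RHS]card_ord; apply: eq_card => x; rewrite !inE andbT.
have /connectP[[|y p] /= pth e] := connect_root adj0 x; last by [].
by rewrite /roots e eqxx.
Qed.

Lemma cyclomaticE (n : nat) (adj : rel 'I_n) :
  simple_graph adj -> (cyclomatic adj + n = num_edges adj + num_comps adj)%N.
Proof. by move/edges_comps_ge => h; rewrite /cyclomatic subnK. Qed.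

Lemma cyclomatic_sub (n : nat) (adj adj' : rel 'I_n) :
  simple_graph adj -> simple_graph adj' -> subrel adj' adj ->
  (cyclomatic adj' <= cyclomatic adj)%N.
Proof. by move=> gA gA' /(edges_comps_sub gA gA') h; rewrite leq_sub2r. Qed.

Lemma cyclomatic_del_edge (n : nat) (adj : rel 'I_n) u v :
  simple_graph adj -> adj u v -> connect (del_edge adj u v) u v ->
  (cyclomatic (del_edge adj u v) < cyclomatic adj)%N.
Proof.
move=> gA auv cuv; have := cyclomaticE gA.
have := cyclomaticE (del_edge_simple u v gA).
rewrite (eq_num_comps (connect_del_edge gA cuv)) (num_edges_del_edge gA auv).
by lia.
Qed.

(** * Cycles as lists, and deletions that lower the cyclomatic number *)

Lemma next_last (T : eqType) (x : T) p : uniq (x :: p) -> next (x :: p) (last x p) = x.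
Proof.
by move=> Up; have := cycle_next Up; rewrite /= rcons_path => /andP[_ /eqP].
Qed.

Lemma is_cycle_rot (n : nat) (adj : rel 'I_n) i c :
  is_cycle adj (rot i c) = is_cycle adj c.
Proof. by rewrite /is_cycle size_rot rot_uniq rot_cycle. Qed.

Lemma cycle_edge_in (n : nat) (c : seq 'I_n) x y :
  cycle_edge c x y -> (x \in c) && (y \in c).
Proof.
case/andP=> xc; rewrite xc => /orP[/eqP -> |/eqP e]; first by rewrite mem_next.
by rewrite -mem_next -e.
Qed.

Lemma cycle_edge_adj (n : nat) (adj : rel 'I_n) c x y :
  simple_graph adj -> is_cycle adj c -> cycle_edge c x y -> adj x y.
Proof.
move=> gA /and3P[_ _ cc] h; have /andP[xc yc] := cycle_edge_in h.
case/andP: h => _ /orP[/eqP ->|/eqP ->]; first exact: next_cycle.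
by rewrite gA.1; apply: next_cycle.
Qed.

Lemma is_cycle_path (n : nat) (adj : rel 'I_n) x p :
  is_cycle adj (x :: p) -> path (del_edge adj x (last x p)) x p.
Proof.
case/and3P; set y := last x p; have : last x p = y by [].
move: y => y; case: p => // d p /= la; rewrite ltnS => sz.
rewrite inE negb_or => /and3P[/andP[xd xp] dp Up].
rewrite rcons_path => /and3P[axd pth _].
rewrite /del_edge axd eqxx /=; apply/andP; split.
  apply/norP; split.
    (* A cycle has at least three vertices, so [p] is nonempty and the first step does not already
       end at [y]. *)
    have lp : last d p \in p.
      by case: p sz {xp dp Up pth la} => // e p _; rewrite /= mem_last.
    by apply: contraNneq dp => ->; rewrite -la.
  by apply: contraNN xd => /andP[/eqP -> /eqP ->].
move: pth xd xp {axd dp Up la sz}; elim: p d => //= e p IH d /andP[ade pth] xd.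
rewrite inE negb_or => /andP[xe xp].
by rewrite ade (eq_sym d x) (negbTE xd) (eq_sym e x) (negbTE xe) andbF; apply: IH.
Qed.

Lemma cycle_edge_connect (n : nat) (adj : rel 'I_n) c x y :
  simple_graph adj -> is_cycle adj c -> cycle_edge c x y ->
  connect (del_edge adj x y) x y.
Proof.
move=> gA cc.
have core a b : a \in c -> b = next c a -> connect (del_edge adj b a) b a.
  move=> ac eb; have bc : b \in c by rewrite eb mem_next.
  have [i p ep] := rot_to bc.
  have := cc; rewrite -(is_cycle_rot _ i) ep => ccp.
  have Uc : uniq c by have /and3P[] := cc.
  have la : last b p = a.
    apply: (can_inj (prev_next Uc)); rewrite -eb -(next_rot i Uc) ep.
    by apply: next_last; have /and3P[] := ccp.
  by apply/connectP; exists p; rewrite -?la //; apply: is_cycle_path.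
move=> h; have /andP[xc yc] := cycle_edge_in h.
have [sD _] := del_edge_simple x y gA.
case/andP: h => _ /orP[/eqP e|/eqP e]; last exact: core.
rewrite (sym_connect_sym sD) (eq_connect (del_edgeC adj x y)); exact: core.
Qed.

(** A duplicate-free path from [x] to [y] that avoids the edge [xy] has at least two edges, so
    closing it with [xy] gives a genuine cycle. *)
Lemma connect_cycle_edge (n : nat) (adj : rel 'I_n) x y :
  simple_graph adj -> adj x y -> connect (del_edge adj x y) x y ->
  exists p, [/\ path (del_edge adj x y) x p, last x p = y,
               is_cycle adj (x :: p) & cycle_edge (x :: p) x y].
Proof.
move=> gA axy /connectP[q pq eq].
move: eq; case/shortenP: pq => p pp Up _ ey; exists p.
have neq : x != y by apply: contraTneq axy => ->; rewrite gA.2.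
have ce : cycle_edge (x :: p) x y.
  by rewrite /cycle_edge mem_head ey next_last // eqxx orbT.
split => //; apply/and3P; split => //.
  case: p pp Up ey {ce} => [_ _ e|a [|b p]] //=; first by rewrite e eqxx in neq.
  by move=> pp _ e; move: pp; rewrite e /= del_edgexx.
rewrite /= rcons_path -ey gA.1 axy andbT.
by apply: sub_path pp => a b; exact: del_edge_sub.
Qed.

Lemma sub_is_cycle (n : nat) (adj adj' : rel 'I_n) c :
  {in c &, subrel adj' adj} -> is_cycle adj' c -> is_cycle adj c.
Proof.
move=> s /and3P[sz U cc]; apply/and3P; split => //.
by apply: (sub_in_cycle s) cc; apply/allP.
Qed.

Lemma cyclomatic_del_vert (n : nat) (adj : rel 'I_n) c x :
  simple_graph adj -> is_cycle adj c -> x \in c ->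
  (cyclomatic (del_verts adj [set x]) < cyclomatic adj)%N.
Proof.
move=> gA cc xc.
have ce : cycle_edge c x (next c x) by rewrite /cycle_edge xc eqxx.
have axy := cycle_edge_adj gA cc ce.
apply: leq_ltn_trans (cyclomatic_del_edge gA axy (cycle_edge_connect gA cc ce)).
apply: cyclomatic_sub; first exact: del_edge_simple.
  exact: del_verts_simple.
move=> a b /and3P[aab]; rewrite !inE => /negbTE ax /negbTE bx.
by rewrite /del_edge aab ax bx andbF.
Qed.

Lemma is_cycle_del_edge (n : nat) (adj : rel 'I_n) c x y :
  is_cycle adj c -> ~~ cycle_edge c x y -> is_cycle (del_edge adj x y) c.
Proof.
move=> /and3P[sz U cyc] e; apply/and3P; split => //.
apply: cycle_from_next => // a ac; rewrite /del_edge next_cycle //=.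
apply: contra e => /orP[] /andP[/eqP ea /eqP <-]; rewrite -ea.
  by rewrite /cycle_edge ac eqxx.
by rewrite /cycle_edge mem_next ac eqxx orbT.
Qed.

(** Two successive drops: removing the edge [xy] of [c1] lowers theta once, and since [c2] survives
    this, removing [x] lowers it again. *)
Lemma cyclomatic_del_vert2 (n : nat) (adj : rel 'I_n) c1 c2 x y :
  simple_graph adj -> is_cycle adj c1 -> is_cycle adj c2 -> x \in c2 ->
  cycle_edge c1 x y -> ~~ cycle_edge c2 x y ->
  ((cyclomatic (del_verts adj [set x])).+1 < cyclomatic adj)%N.
Proof.
move=> gA cc1 cc2 xc2 e1 e2.
have axy := cycle_edge_adj gA cc1 e1.
have gD := del_edge_simple x y gA.
apply: leq_ltn_trans (cyclomatic_del_edge gA axy (cycle_edge_connect gA cc1 e1)).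
have cc2' := is_cycle_del_edge cc2 e2.
apply: leq_ltn_trans (cyclomatic_del_vert gD cc2' xc2).
apply: cyclomatic_sub; try exact: del_verts_simple.
move=> a b /and3P[aab ax bx]; rewrite /del_verts ax bx !andbT /del_edge aab /=.
by move: ax bx; rewrite !inE => /negbTE -> /negbTE ->; rewrite andbF.
Qed.

(** * Potentials, switching and balanced gain graphs *)

(** A switching function: conjugation by the diagonal matrix of [d] turns [gain_adj_mx] into the 0-1
    adjacency matrix. *)
Definition potential (C : numClosedFieldType) (n : nat) (adj : rel 'I_n)
  (phi : 'I_n -> 'I_n -> C) (d : 'I_n -> C) : Prop :=
  (forall x, d x != 0) /\ (forall x y, adj x y -> phi x y = (d x)^-1 * d y).

Definition inv_gain (C : numClosedFieldType) (n : nat) (adj : rel 'I_n)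
  (phi : 'I_n -> 'I_n -> C) : Prop :=
  forall x y, adj x y -> phi x y * phi y x = 1.

Lemma unit_gain_inv (C : numClosedFieldType) (n : nat) (adj : rel 'I_n)
  (phi : 'I_n -> 'I_n -> C) : unit_gain adj phi -> inv_gain adj phi.
Proof. by move=> u x y /u[nrm ->]; rewrite -normCK nrm expr1n. Qed.

Lemma sub_inv_gain (C : numClosedFieldType) (n : nat) (adj adj' : rel 'I_n)
  (phi : 'I_n -> 'I_n -> C) :
  subrel adj' adj -> inv_gain adj phi -> inv_gain adj' phi.
Proof. by move=> s g x y /s/g. Qed.

Lemma map_next_perm (T : eqType) (c : seq T) :
  uniq c -> perm_eq [seq next c a | a <- c] c.
Proof.
move=> U; apply: uniq_perm => //.
  by rewrite map_inj_uniq //; apply: can_inj (prev_next U).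
move=> x; apply/mapP/idP => [[a ac ->]|xc]; first by rewrite mem_next.
by exists (prev c x); rewrite ?mem_prev ?next_prev.
Qed.

(** Switching by [d] leaves the gain of a cycle unchanged, since the factors of [d] cancel around
    it, and gives every edge of the path gain 1; only the closing edge contributes. *)
Lemma cycle_gain_path (C : numClosedFieldType) (n : nat) (adj : rel 'I_n)
  (phi : 'I_n -> 'I_n -> C) d x p :
  potential adj phi d -> uniq (x :: p) -> path adj x p ->
  cycle_gain phi (x :: p) = (d x)^-1 * d (last x p) * phi (last x p) x.
Proof.
move=> [d0 pd] U pth; set c := x :: p; set l := last x p.
pose psi a b := d a * phi a b * (d b)^-1.
have E : cycle_gain phi c = \prod_(a <- c) psi a (next c a).
  rewrite /cycle_gain /psi !big_split /=.
  have -> : \prod_(a <- c) (d (next c a))^-1 = \prod_(a <- c) (d a)^-1.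
    rewrite -(big_map (next c) xpredT (fun a => (d a)^-1)).
    by apply: perm_big; apply: (map_next_perm U).
  rewrite prodfV mulrC mulrA mulVf ?mul1r //.
  by rewrite prodf_seq_neq0; apply/allP => a _; rewrite d0.
have lc : l \in c by apply: mem_last.
rewrite E (bigD1_seq l) // big_seq_cond big1.
  by rewrite /psi (next_last U) mulrC mulrA; apply: mulr1.
move=> a /andP[ac al].
(* The closing edge need not lie in [adj]. Relaxing the relation at [l] makes the list a cycle, so
   that [next_cycle] yields adjacency at all other vertices. *)
have : cycle (fun a b => adj a b || (a == l)) c.
  rewrite /= rcons_path eqxx orbT andbT; apply: sub_path pth => u v.
  by move=> /= ->.
move/next_cycle => /(_ _ ac); rewrite (negbTE al) orbF => /pd h.
by rewrite /psi h mulrA divff // mul1r divff.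
Qed.

Lemma inv_gain_neq0 (C : numClosedFieldType) (n : nat) (adj : rel 'I_n)
  (phi : 'I_n -> 'I_n -> C) u v :
  inv_gain adj phi -> adj u v -> phi u v != 0 /\ phi v u = (phi u v)^-1.
Proof.
move=> iG /iG iuv; have uv0 : phi u v != 0.
  by apply: contra_eq_neq iuv => ->; rewrite mul0r eq_sym oner_neq0.
by split=> //; rewrite -[RHS]mulr1 -iuv mulKf.
Qed.

Lemma potential_close (C : numClosedFieldType) (n : nat) (adj : rel 'I_n)
  (phi : 'I_n -> 'I_n -> C) d u v p :
  inv_gain adj phi -> adj u v -> potential (del_edge adj u v) phi d ->
  uniq (u :: p) -> path (del_edge adj u v) u p -> last u p = v ->
  cycle_gain phi (u :: p) = 1 -> potential adj phi d.
Proof.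
move=> iG auv [d0 pd] U pth lp.
have [uv0 evu] := inv_gain_neq0 iG auv.
rewrite (cycle_gain_path (conj d0 pd) U pth) lp evu => e.
have euv : phi u v = (d u)^-1 * d v by rewrite -[LHS]mul1r -e divfK.
split=> // x y /(@del_edge_or _ _ u v)[/pd //|[-> ->] //|[-> ->]].
by rewrite evu euv invfM invrK mulrC.
Qed.

(** Induction on edges. If the removed edge closes a cycle, the gain 1 of this cycle makes the
    potential fit the edge; if it is a bridge, the potential is rescaled on one side. *)
Lemma balanced_potential (C : numClosedFieldType) (n : nat) (adj : rel 'I_n)
  (phi : 'I_n -> 'I_n -> C) :
  simple_graph adj -> inv_gain adj phi ->
  (forall c, is_cycle adj c -> cycle_gain phi c = 1) ->
  exists d, potential adj phi d.
Proof.
have [m] := ubnP (num_edges adj).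
elim: m adj => [|m IH] adj lt_m gA iG bal; first by exfalso; rewrite ltn0 in lt_m.
have [/existsP[u /existsP[v auv]]|] := boolP [exists u, exists v, adj u v]; last first.
  rewrite negb_exists => /forallP noe; exists (fun _ => 1); split=> [x|x y axy].
    exact: oner_neq0.
  by move: (noe x); rewrite negb_exists => /forallP/(_ y); rewrite axy.
have gD := del_edge_simple u v gA.
have [d [d0 pd]] : exists d, potential (del_edge adj u v) phi d.
  apply: IH => //.
  - by move: lt_m; rewrite (num_edges_del_edge gA auv).
  - by apply: sub_inv_gain iG; exact: del_edge_sub.
  - by move=> c cc; apply: bal; apply: sub_is_cycle cc => ? ? _ _ /del_edge_sub.
have [uv0 evu] := inv_gain_neq0 iG auv.
have [cuv|ncuv] := boolP (connect (del_edge adj u v) u v).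
  have [p [pth lp cc _]] := connect_cycle_edge gA auv cuv.
  have /and3P[_ U _] := cc.
  by exists d; apply: (potential_close iG auv (conj d0 pd) U pth lp (bal _ cc)).
have sD := sym_connect_sym gD.1.
(* With this factor on the component of [v], [d' u = d u] and [d' v = phi u v * d u], which is the
   condition on the edge [uv]. *)
pose t := phi u v * d u / d v.
pose d' x := if connect (del_edge adj u v) v x then t * d x else d x.
have t0 : t != 0 by rewrite !mulf_neq0 ?invr_eq0.
exists d'; split=> [x|x y].
  by rewrite /d'; case: ifP => // _; rewrite mulf_neq0.
have du : d' u = d u by rewrite /d' sD (negbTE ncuv).
have dv : d' v = t * d v by rewrite /d' connect0.
have euv : phi u v = (d' u)^-1 * d' v.
  by rewrite du dv /t divfK // mulrC mulfK.
case/(@del_edge_or _ _ u v)=> [axy|[-> ->]|[-> ->]].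
- have <- : (d x)^-1 * d y = (d' x)^-1 * d' y; last exact: pd.
  rewrite /d' -(same_connect_r sD (connect1 axy)); case: ifP => // _.
  by rewrite invfM mulrACA mulVf // mul1r.
- exact: euv.
- by rewrite evu euv invfM invrK mulrC.
Qed.

(** * Ranks under scaling and vertex deletion; extremal gain graphs *)

Lemma mxrank_scale_le (F : fieldType) (m n : nat) (M : 'M[F]_(m, n))
  (a : 'I_m -> F) (b : 'I_n -> F) :
  (\rank (\matrix_(i, j) (a i * M i j * b j)%R) <= \rank M)%N.
Proof.
have -> : \matrix_(i, j) (a i * M i j * b j) =
    diag_mx (\row_i a i) *m M *m diag_mx (\row_j b j).
  by apply/matrixP => i j; rewrite mul_mx_diag mul_diag_mx !mxE.
exact: leq_trans (mxrankM_maxl _ _) (mxrankM_maxr _ _).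
Qed.

Lemma potential_rank (C : numClosedFieldType) (n : nat) (adj : rel 'I_n)
  (phi : 'I_n -> 'I_n -> C) d :
  potential adj phi d -> \rank (gain_adj_mx adj phi) = \rank (adj_mx C adj).
Proof.
move=> [d0 pd]; apply/eqP; rewrite eqn_leq; apply/andP; split.
  have -> : gain_adj_mx adj phi =
      \matrix_(i, j) ((d i)^-1 * adj_mx C adj i j * d j).
    apply/matrixP => i j; rewrite !mxE; case: ifP => [/pd ->|_].
      by rewrite mulr1.
    by rewrite mulr0 mul0r.
  exact: mxrank_scale_le.
have -> : adj_mx C adj =
    \matrix_(i, j) (d i * gain_adj_mx adj phi i j * (d j)^-1).
  apply/matrixP => i j; rewrite !mxE; case: ifP => [/pd ->|_].
    by rewrite mulrA divff // mul1r divff.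
  by rewrite mulr0 mul0r.
exact: mxrank_scale_le.
Qed.

Lemma adj_mxE (C : numClosedFieldType) (n : nat) (adj : rel 'I_n) :
  adj_mx C adj = gain_adj_mx adj (fun _ _ => 1).
Proof. by apply/matrixP => i j; rewrite !mxE; case: ifP. Qed.

Lemma rank_del_verts_le (C : numClosedFieldType) (n : nat) (adj : rel 'I_n)
  (phi : 'I_n -> 'I_n -> C) D :
  (\rank (gain_adj_mx (del_verts adj D) phi) <= \rank (gain_adj_mx adj phi))%N.
Proof.
have -> : gain_adj_mx (del_verts adj D) phi =
  \matrix_(i, j) ((i \notin D)%:R * gain_adj_mx adj phi i j * (j \notin D)%:R).
  apply/matrixP => i j; rewrite !mxE /del_verts.
  by case: (i \in D); case: (j \in D);
    rewrite /= ?andbF ?andbT ?mulr0 ?mul0r ?mul1r ?mulr1.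
exact: mxrank_scale_le.
Qed.

Lemma mulmx_delta (R : pzRingType) (m n : nat) (M : 'M[R]_(m, n)) (x : 'I_n) i j :
  (M *m delta_mx x x) i j = M i x * (j == x)%:R.
Proof.
rewrite mxE (bigD1 x) //= big1 ?addr0 => [|k kx]; last first.
  by rewrite [delta_mx _ _ _ _]mxE (negbTE kx) mulr0.
by rewrite [delta_mx _ _ _ _]mxE eqxx.
Qed.

Lemma delta_mulmx (R : pzRingType) (m n : nat) (M : 'M[R]_(m, n)) (x : 'I_m) i j :
  (delta_mx x x *m M) i j = (i == x)%:R * M x j.
Proof.
rewrite mxE (bigD1 x) //= big1 ?addr0 => [|k kx]; last first.
  by rewrite [delta_mx _ _ _ _]mxE (negbTE kx) andbF mul0r.
by rewrite [delta_mx _ _ _ _]mxE eqxx andbT.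
Qed.

Lemma rank_del_vert_ge (C : numClosedFieldType) (n : nat) (adj : rel 'I_n)
  (phi : 'I_n -> 'I_n -> C) x :
  (\rank (gain_adj_mx adj phi) <=
   (\rank (gain_adj_mx (del_verts adj [set x]) phi)).+2)%N.
Proof.
set M := gain_adj_mx adj phi; set M' := gain_adj_mx _ _.
(* Row [x] and column [x] are split off as two matrices of rank at most one; [Q] has row [x] cleared
   so that the entry at [(x, x)] is counted once. *)
pose Q := \matrix_(i, j) ((i != x)%:R * M i j).
have -> : M = M' + (delta_mx x x *m M + Q *m delta_mx x x).
  apply/matrixP => i j; rewrite [RHS]mxE [X in _ + X]mxE delta_mulmx mulmx_delta.
  rewrite !mxE /del_verts !inE; case: (eqVneq i x) => [->|ix]; case: (eqVneq j x) => [->|jx];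
    by rewrite /= ?andbF ?andbT /= ?mulr0 ?mul0r ?mul1r ?mulr1 ?addr0 ?add0r.
apply: leq_trans (mxrank_add _ _) _.
rewrite -addn2 leq_add2l; apply: leq_trans (mxrank_add _ _) _.
rewrite -[2%N]/(1 + 1)%N leq_add //.
  by apply: leq_trans (mxrankM_maxl _ _) _; rewrite mxrank_delta.
by apply: leq_trans (mxrankM_maxr _ _) _; rewrite mxrank_delta.
Qed.

Lemma gain_rank_le (C : numClosedFieldType) (n : nat) (adj : rel 'I_n)
  (phi : 'I_n -> 'I_n -> C) :
  simple_graph adj -> inv_gain adj phi ->
  (\rank (gain_adj_mx adj phi) <= \rank (adj_mx C adj) + 2 * cyclomatic adj)%N.
Proof.
have [m] := ubnP (cyclomatic adj).
elim: m adj => [|m IH] adj lt_m gA iG; first by exfalso; rewrite ltn0 in lt_m.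
have [[c cc]|nocycle] := pselect (exists c, is_cycle adj c); last first.
  have [d pd] : exists d, potential adj phi d.
    by apply: balanced_potential => // c cc; case: nocycle; exists c.
  by rewrite (potential_rank pd) leq_addr.
have [x xc] : exists x, x \in c.
  by case/and3P: cc; case: c => // x c _ _ _; exists x; rewrite mem_head.
have lt := cyclomatic_del_vert gA cc xc.
have gD := del_verts_simple [set x] gA.
have := IH _ (leq_trans lt lt_m) gD (sub_inv_gain (@del_verts_sub _ _ _) iG).
have := rank_del_vert_ge adj phi x.
have := rank_del_verts_le adj (fun _ _ => 1 : C) [set x].
rewrite -!adj_mxE => h1 h2 h3.
have arith (a a' b b' t t' : nat) : (b' <= b -> a <= a'.+2 -> a' <= b' + 2 * t' ->
  t' < t -> a <= b + 2 * t)%N by lia.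
exact: arith h1 h2 h3 lt.
Qed.

Definition extremal (C : numClosedFieldType) (n : nat) (adj : rel 'I_n)
  (phi : 'I_n -> 'I_n -> C) : Prop :=
  [/\ simple_graph adj, inv_gain adj phi &
      \rank (gain_adj_mx adj phi) = (\rank (adj_mx C adj) + 2 * cyclomatic adj)%N].

(** The chain r(Phi) <= r(Phi - x) + 2 <= r(G - x) + 2 theta(G - x) + 2 <= r(G) + 2 theta(G) has
    equal ends, so every link is an equality. *)
Lemma extremal_del_vert (C : numClosedFieldType) (n : nat) (adj : rel 'I_n)
  (phi : 'I_n -> 'I_n -> C) c x :
  extremal adj phi -> is_cycle adj c -> x \in c ->
  [/\ extremal (del_verts adj [set x]) phi,
      \rank (adj_mx C (del_verts adj [set x])) = \rank (adj_mx C adj) &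
      cyclomatic adj = (cyclomatic (del_verts adj [set x])).+1].
Proof.
move=> [gA iG eq] cc xc.
have lt := cyclomatic_del_vert gA cc xc.
have gD := del_verts_simple [set x] gA.
have iD := sub_inv_gain (@del_verts_sub _ adj [set x]) iG.
have h1 := gain_rank_le gD iD.
have h2 := rank_del_vert_ge adj phi x.
have h3 := rank_del_verts_le adj (fun _ _ => 1 : C) [set x].
rewrite -!adj_mxE in h3.
have arith (a a' b b' t t' : nat) : (a = b + 2 * t -> b' <= b -> a <= a'.+2 ->
  a' <= b' + 2 * t' -> t' < t -> [/\ a' = b' + 2 * t', b' = b & t = t'.+1])%N.
  by move=> *; split; lia.
by have [? ? ?] := arith _ _ _ _ _ _ eq h3 h2 h1 lt.
Qed.

(** Edge relations are compared instead of lists, because all rotations and reversals of a list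
    represent the same cycle. *)
Definition disjoint_cycles (n : nat) (adj : rel 'I_n) : Prop :=
  forall c1 c2, is_cycle adj c1 -> is_cycle adj c2 ->
    ~~ [disjoint c1 & c2] -> cycle_edge c1 =2 cycle_edge c2.

Lemma next_closed_subset (n : nat) (c : seq 'I_n) (P : pred 'I_n) x :
  uniq c -> x \in c -> P x ->
  {in c, forall a, P a -> P (next c a)} -> {in c, forall a, P a}.
Proof.
move=> U xc Px step a ac.
have := ac; rewrite -(fconnect_cycle (cycle_next U) xc) => /iter_findex <-.
elim: (findex _ _ _) => //= k IH; apply: step => //.
by elim: k {IH} => //= k; rewrite mem_next.
Qed.

(** If an edge of [c1] at a vertex of [c2] were not an edge of [c2], deleting that vertex would
    lower theta by two, against the drop of exactly one. Following [next c1] from a common vertex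
    then carries all of [c1] into [c2]. *)
Lemma extremal_disjoint_cycles (C : numClosedFieldType) (n : nat) (adj : rel 'I_n)
  (phi : 'I_n -> 'I_n -> C) : extremal adj phi -> disjoint_cycles adj.
Proof.
move=> ext.
have A c1 c2 x y : is_cycle adj c1 -> is_cycle adj c2 -> x \in c2 ->
    cycle_edge c1 x y -> cycle_edge c2 x y.
  move=> cc1 cc2 xc2 e1; apply/negPn/negP => e2.
  have [gA _ _] := ext.
  have := cyclomatic_del_vert2 gA cc1 cc2 xc2 e1 e2.
  have [_ _ ->] := extremal_del_vert ext cc2 xc2.
  by rewrite ltnn.
have B c1 c2 : is_cycle adj c1 -> is_cycle adj c2 -> ~~ [disjoint c1 & c2] ->
    {subset c1 <= c2}.
  move=> cc1 cc2 /pred0Pn[x /andP[/= xc1 xc2]].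
  have /and3P[_ U _] := cc1.
  apply: (next_closed_subset U xc1 xc2) => a ac1 ac2 /=.
  have /(A _ c2 _ _ cc1) : cycle_edge c1 a (next c1 a) by rewrite /cycle_edge ac1 eqxx.
  by move=> /(_ cc2 ac2) /cycle_edge_in/andP[].
move=> c1 c2 cc1 cc2 nd x y; apply/idP/idP => e.
  apply: (A c1) => //; apply: (B c1) => //.
  by have /andP[] := cycle_edge_in e.
apply: (A c2) => //; apply: (B c2) => //; first by rewrite disjoint_sym.
by have /andP[] := cycle_edge_in e.
Qed.

Lemma sub_disjoint_cycles (n : nat) (adj adj' : rel 'I_n) :
  subrel adj' adj -> disjoint_cycles adj -> disjoint_cycles adj'.
Proof.
move=> s dc c1 c2 cc1 cc2; apply: dc; [apply: sub_is_cycle cc1|apply: sub_is_cycle cc2];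
  by move=> a b _ _ /s.
Qed.

(** * Kernel vectors of the adjacency matrix under vertex deletion *)

Definition harmonic (C : numClosedFieldType) (n : nat) (adj : rel 'I_n)
  (z : 'I_n -> C) : Prop := forall v, \sum_(u | adj v u) z u = 0.

Lemma harmonicP (C : numClosedFieldType) (n : nat) (adj : rel 'I_n) (z : 'I_n -> C) :
  simple_graph adj -> harmonic adj z <-> (\row_i z i) *m adj_mx C adj = 0.
Proof.
move=> [sA _].
have E v : ((\row_i z i) *m adj_mx C adj) ord0 v = \sum_(u | adj v u) z u.
  rewrite mxE [RHS]big_mkcond; apply: eq_bigr => u _; rewrite !mxE sA.
  by case: (adj v u); rewrite ?mulr1 ?mulr0.
split=> [h|h v]; first by apply/rowP => v; rewrite E h mxE.
by rewrite -E h mxE.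
Qed.

Lemma adj_mx_sym (C : numClosedFieldType) (n : nat) (adj : rel 'I_n) :
  simple_graph adj -> (adj_mx C adj)^T = adj_mx C adj.
Proof. by case=> sA _; apply/matrixP => i j; rewrite !mxE sA. Qed.

Lemma codelta_mulmx (R : pzRingType) (m n : nat) (M : 'M[R]_(m, n)) (x : 'I_m) i j :
  ((1%:M - delta_mx x x) *m M) i j = (i != x)%:R * M i j.
Proof.
rewrite mulmxBl mul1mx 2!mxE delta_mulmx.
by case: eqVneq => [->|_]; rewrite ?mul1r ?mul0r ?subrr ?subr0.
Qed.

Lemma mulmx_codelta (R : pzRingType) (m n : nat) (M : 'M[R]_(m, n)) (x : 'I_n) i j :
  (M *m (1%:M - delta_mx x x)) i j = M i j * (j != x)%:R.
Proof.
rewrite mulmxBr mulmx1 2!mxE mulmx_delta.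
by case: eqVneq => [->|_]; rewrite ?mulr1 ?mulr0 ?subrr ?subr0.
Qed.

(** With [P] the projection that kills coordinate [x], r(PAP) <= r(PA) <= r(A) has equal ends. So
    row [x] of [A] is a combination of the other rows. *)
Lemma rank_del_vert_row (C : numClosedFieldType) (n : nat) (adj : rel 'I_n) x :
  simple_graph adj ->
  \rank (adj_mx C (del_verts adj [set x])) = \rank (adj_mx C adj) ->
  exists D : 'M[C]_n, adj_mx C adj = D *m ((1%:M - delta_mx x x) *m adj_mx C adj).
Proof.
move=> gA; set A := adj_mx C adj; set P := 1%:M - delta_mx x x => e.
have E : adj_mx C (del_verts adj [set x]) = P *m A *m P.
  apply/matrixP => i j.
  rewrite mulmx_codelta codelta_mulmx !mxE /del_verts !inE.
  by case: (i != x); case: (j != x);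
    rewrite /= ?andbF ?andbT /= ?mulr0 ?mul0r ?mul1r ?mulr1.
have sub : (P *m A <= A)%MS := submxMl P A.
have : (A <= P *m A)%MS.
  have [le <-] := mxrank_leqif_sup sub; rewrite eqn_leq le /= -e E.
  exact: mxrankM_maxl.
by case/submxP=> D eD; exists D.
Qed.

Lemma rank_del_vert_harmonic (C : numClosedFieldType) (n : nat) (adj : rel 'I_n) x :
  simple_graph adj ->
  \rank (adj_mx C (del_verts adj [set x])) = \rank (adj_mx C adj) ->
  exists z : 'I_n -> C, harmonic adj z /\ z x = 1.
Proof.
move=> gA e; have [D eD] := rank_del_vert_row gA e.
(* The unit vector at [x] minus the combination of the other rows that produces row [x]; the
   projection keeps the coefficient at [x] equal to 1. *)
pose u := delta_mx 0 x - delta_mx 0 x *m D *m (1%:M - delta_mx x x) : 'rV[C]_n.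
exists (u 0); split.
  apply/harmonicP => //; have -> : \row_i u 0 i = u by apply/rowP => i; rewrite mxE.
  by rewrite mulmxBl -!mulmxA -eD subrr.
by rewrite /u mxE [X in _ + X]mxE mulmx_codelta eqxx mulr0 subr0 mxE !eqxx.
Qed.

(** By symmetry column [x] is a combination of the other columns, so the kernel equation at [x]
    follows from those at the other vertices, which do not see the deletion because [z x = 0]. *)
Lemma rank_del_vert_extend (C : numClosedFieldType) (n : nat) (adj : rel 'I_n) x z :
  simple_graph adj ->
  \rank (adj_mx C (del_verts adj [set x])) = \rank (adj_mx C adj) ->
  harmonic (del_verts adj [set x]) z -> z x = 0 -> harmonic adj (z : _ -> C).
Proof.
move=> gA e hz zx; have [D eD] := rank_del_vert_row gA e.
apply/harmonicP => //; set v := \row_i z i; set A := adj_mx C adj in eD *.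
have := congr1 trmx eD; rewrite !trmx_mul linearB /= trmx1 trmx_delta.
rewrite /A !(adj_mx_sym C gA) -/A => ->.
rewrite !mulmxA; suff -> : v *m A *m (1%:M - delta_mx x x) = 0 by rewrite mul0mx.
apply/rowP => w; rewrite mulmx_codelta [RHS]mxE.
have [->|wx] := eqVneq w x; first by rewrite mulr0.
rewrite mulr1 mxE -[RHS](hz w) [RHS]big_mkcond; apply: eq_bigr => u _.
rewrite !mxE /del_verts !inE wx /= gA.1.
by have [->|ux] := eqVneq u x; case: (adj w _); rewrite ?mulr1 ?mulr0 ?zx.
Qed.

Lemma del_verts0 (n : nat) (adj : rel 'I_n) : del_verts adj set0 = adj.
Proof. by apply/funext => x; apply/funext => y; rewrite /del_verts !inE !andbT. Qed.

Lemma del_vertsU (n : nat) (adj : rel 'I_n) D E :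
  del_verts (del_verts adj D) E = del_verts adj (D :|: E).
Proof.
apply/funext => x; apply/funext => y; rewrite /del_verts !inE !negb_or.
by case: (adj x y); case: (x \in D); case: (y \in D); case: (x \in E).
Qed.

(** Cycle vertices satisfying [Q] are deleted one by one until no cycle meets [Q]. Each deletion
    preserves the rank of A(G), so kernel vectors vanishing on [D] pass back to the original
    graph. *)
Lemma extremal_strip (C : numClosedFieldType) (n : nat) (adj : rel 'I_n)
  (phi : 'I_n -> 'I_n -> C) (Q : pred 'I_n) :
  extremal adj phi ->
  exists D : {set 'I_n},
   [/\ {in D, forall x, Q x}, extremal (del_verts adj D) phi,
       (forall z : 'I_n -> C, harmonic (del_verts adj D) z ->
          {in D, forall x, z x = 0} -> harmonic adj z) &
       (forall c, is_cycle (del_verts adj D) c -> {in c, forall x, ~~ Q x})].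
Proof.
have [m] := ubnP (cyclomatic adj).
elim: m adj => [|m IH] adj lt_m ext; first by exfalso; rewrite ltn0 in lt_m.
have [[c [x [cc xc Qx]]]|no] := pselect (exists c x, [/\ is_cycle adj c, x \in c & Q x]).
  have [ext' rk th] := extremal_del_vert ext cc xc.
  have [gA _ _] := ext.
  have [|D [DQ eD ker nc]] := IH _ _ ext'; first by rewrite -ltnS -th.
  exists ([set x] :|: D); rewrite -del_vertsU; split=> //.
    by move=> a; rewrite !inE => /orP[/eqP ->|/DQ].
  move=> z hz z0; apply: (rank_del_vert_extend gA rk); last by apply: z0; rewrite !inE eqxx.
  by apply: ker => // a aD; apply: z0; rewrite !inE aD orbT.
exists set0; rewrite del_verts0; split=> // [x|c cc x xc]; first by rewrite inE.
by apply/negP => Qx; apply: no; exists c, x.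
Qed.

(** * Kernel vectors across a bridge *)

Section Bridge.
Variables (C : numClosedFieldType) (n : nat) (adj : rel 'I_n) (x y : 'I_n).
Hypotheses (gA : simple_graph adj) (axy : adj x y).
Hypothesis bridge : ~~ connect (del_edge adj x y) x y.

Local Notation B := (connect (del_edge adj x y) y).

Lemma bridge_notin : ~~ B x.
Proof. by rewrite (sym_connect_sym (del_edge_simple x y gA).1). Qed.

Lemma bridge_boundary v u : B v -> adj v u -> ~~ B u -> v = y /\ u = x.
Proof.
move=> Bv /(@del_edge_or _ _ x y)[/connect1/(connect_trans Bv) -> //|[ev _]|//] _.
by move: Bv; rewrite ev (negbTE bridge_notin).
Qed.

Lemma bridge_sum (z : 'I_n -> C) v :
  B v -> \sum_(u | adj v u) z u =
         \sum_(u | adj v u && B u) z u + (if v == y then z x else 0).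
Proof.
move=> Bv; rewrite (bigID B) /=; congr (_ + _); case: eqVneq => [->|vy].
  rewrite (bigD1 x) /=; last by rewrite gA.1 axy bridge_notin.
  rewrite big1 ?addr0 // => u /andP[/andP[ayu nB] ux].
  have [_ e] := bridge_boundary (connect0 _ _) ayu nB.
  by rewrite e eqxx in ux.
rewrite big1 // => u /andP[avu nB].
by have [e _] := bridge_boundary Bv avu nB; rewrite e eqxx in vy.
Qed.

(** The kernel equations at the vertices of [B] are summed with weights [f]; the only edge leaving
    [B] joins [y] to [x] and gives the boundary term. *)
Lemma bridge_pairing (z f : 'I_n -> C) : harmonic adj z ->
  \sum_(v | B v) \sum_(u | adj v u && B u) f v * z u = - (f y * z x).
Proof.
move=> hz; apply/eqP; rewrite -addr_eq0; apply/eqP.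
have E : \sum_(v | B v) f v * (if v == y then z x else 0) = f y * z x.
  rewrite (bigD1 y) ?connect0 //= eqxx big1 ?addr0 // => v /andP[_ /negbTE ->].
  by rewrite mulr0.
rewrite -E -big_split /= big1 // => v Bv.
by rewrite -mulr_sumr -mulrDr -bridge_sum // hz mulr0.
Qed.

Lemma bridge_swap (z f : 'I_n -> C) :
  \sum_(v | B v) \sum_(u | adj v u && B u) f v * z u =
  \sum_(v | B v) \sum_(u | adj v u && B u) f u * z v.
Proof.
rewrite (exchange_big_dep B) /=; last by move=> v u _ /andP[].
by apply: eq_bigr => u Bu; apply: eq_bigl => v; rewrite gA.1 Bu andbT andbC.
Qed.

(** A discrete Green identity: the pairing over [B] is symmetric in [z] and [z'], so the two
    boundary terms agree. *)
Lemma bridge_wronskian (z z' : 'I_n -> C) :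
  harmonic adj z -> harmonic adj z' -> z' y * z x = z y * z' x.
Proof.
move=> hz hz'; apply: oppr_inj; rewrite -!bridge_pairing // bridge_swap.
by apply: eq_bigr => v _; apply: eq_bigr => u _; rewrite mulrC.
Qed.

(** Weighting by [s v * z v] makes the pairing antisymmetric, since [s] changes sign along every
    edge inside [B]; hence it is zero. As [B] avoids [x], a colouring off [x] suffices. *)
Lemma bridge_bipartite (z s : 'I_n -> C) :
  (forall a b, adj a b -> a != x -> b != x -> s b = - s a) ->
  s y != 0 -> harmonic adj z -> z x * z y = 0.
Proof.
move=> hs sy hz.
have Bx v : B v -> v != x by apply: contraTneq => ->; exact: bridge_notin.
have P := bridge_pairing (fun v => s v * z v) hz.
set S := (X in X = _) in P.
have e : S = - S.
  rewrite {1}/S bridge_swap -sumrN; apply: eq_bigr => v Bv.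
  rewrite -sumrN; apply: eq_bigr => u /andP[avu Bu].
  by rewrite (hs v u) ?Bx // !mulNr mulrAC.
have S0 : S = 0.
  have : S *+ 2 == 0 by rewrite mulr2n {1}e addNr.
  by rewrite mulrn_eq0 => /eqP.
move: P; rewrite S0 => /esym/eqP; rewrite oppr_eq0 !mulf_eq0 (negbTE sy) /=.
by rewrite orbC -mulf_eq0 => /eqP.
Qed.

(** The bipartite identity gives [z0 y = 0], and the Wronskian identity transfers this zero to every
    kernel vector. *)
Lemma bridge_vanish (z0 z s : 'I_n -> C) :
  (forall a b, adj a b -> a != x -> b != x -> s b = - s a) ->
  s y != 0 -> harmonic adj z0 -> z0 x != 0 -> harmonic adj z -> z y = 0.
Proof.
move=> hs sy h0 z0x hz.
have /eqP := bridge_bipartite hs sy h0; rewrite mulf_eq0 (negbTE z0x) /= => /eqP z0y.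
have /eqP := bridge_wronskian h0 hz; rewrite z0y mul0r mulf_eq0 (negbTE z0x) orbF.
by move/eqP.
Qed.

End Bridge.

(** * Kernel vectors along a cycle; cycle lengths and gains *)

(** A cycle through the edge [vu] would share [v] with [c] and so have the edges of [c]. An edge at
    [v] outside [c] is therefore a bridge, and [u] lies off [c], since [c] survives the deletion of
    that edge and would connect its ends. *)
Lemma cycle_neighbor (n : nat) (adj : rel 'I_n) c v u :
  simple_graph adj -> disjoint_cycles adj -> is_cycle adj c -> v \in c -> adj v u ->
  cycle_edge c v u \/ u \notin c /\ ~~ connect (del_edge adj v u) v u.
Proof.
move=> gA dc cc vc avu; have [|nce] := boolP (cycle_edge c v u); first by left.
right.
have nc : ~~ connect (del_edge adj v u) v u.
  apply/negP => /(connect_cycle_edge gA avu)[p [_ _ cc' ce']].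
  have nd : ~~ [disjoint v :: p & c].
    by apply/pred0Pn; exists v; rewrite /= mem_head.
  by rewrite -(dc _ _ cc' cc nd) ce' in nce.
split=> //; apply: contra nc => uc.
have /and3P[_ _ cyc] := is_cycle_del_edge cc nce.
exact: connect_cycle cyc _ _ vc uc.
Qed.

Lemma next_next_neq (T : eqType) (c : seq T) v :
  uniq c -> (2 < size c)%N -> v \in c -> next c (next c v) != v.
Proof.
move=> U sz vc; have [i p ep] := rot_to vc.
have Ur : uniq (rot i c) by rewrite rot_uniq.
rewrite -!(next_rot i U) ep; rewrite -(size_rot i) ep in sz; rewrite ep in Ur.
case: p sz Ur {ep} => [|a [|b p]] //= _.
rewrite !inE !negb_or eqxx => /and3P[/and3P[va vb _] _ _].
by rewrite (eq_sym a v) (negbTE va) eqxx eq_sym.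
Qed.

(** In the kernel equation at [next c v] only the two neighbours along the cycle survive. *)
Lemma harmonic_step (C : numClosedFieldType) (n : nat) (adj : rel 'I_n) c
  (z : 'I_n -> C) v :
  simple_graph adj -> disjoint_cycles adj -> is_cycle adj c -> harmonic adj z ->
  (forall a b, a \in c -> adj a b -> b \notin c -> z b = 0) ->
  v \in c -> z (next c (next c v)) = - z v.
Proof.
move=> gA dc cc hz out vc; have /and3P[sz U cyc] := cc.
set w := next c v; have wc : w \in c by rewrite mem_next.
apply/eqP; rewrite -addr_eq0 -(hz w); apply/eqP/esym.
rewrite (bigD1 (next c w)) /=; last exact: next_cycle.
congr (_ + _); rewrite (bigD1 v) /=; last first.
  by rewrite gA.1 next_cycle // eq_sym next_next_neq.
rewrite big1 ?addr0 // => u /andP[/andP[awu un] uv].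
have [|[uc _]] := cycle_neighbor gA dc cc wc awu; last exact: out awu uc.
case/andP=> _ /orP[e|/eqP e]; first by rewrite e in un.
by move: uv; rewrite (can_inj (prev_next U) e) eqxx.
Qed.

Lemma iter_next_mem (T : eqType) (c : seq T) v k :
  (iter k (next c) v \in c) = (v \in c).
Proof. by elim: k => //= k <-; rewrite mem_next. Qed.

Lemma harmonic_iter (C : numClosedFieldType) (n : nat) (c : seq 'I_n)
  (z : 'I_n -> C) v k :
  {in c, forall a, z (next c (next c a)) = - z a} ->
  v \in c -> z (iter k.*2 (next c) v) = (-1) ^+ k * z v.
Proof.
move=> st vc; elim: k => [|k IH]; first by rewrite mul1r.
by rewrite doubleS !iterS st ?iter_next_mem // IH exprS mulN1r mulNr.
Qed.

Lemma iter_next_size (n : nat) (c : seq 'I_n) v :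
  uniq c -> v \in c -> iter (size c) (next c) v = v.
Proof.
move=> U vc; rewrite -(order_cycle (cycle_next U) U vc).
exact: (iter_order_cycle (cycle_next U)).
Qed.

Lemma harmonic_dvd4 (C : numClosedFieldType) (n : nat) (c : seq 'I_n)
  (z : 'I_n -> C) v :
  uniq c -> {in c, forall a, z (next c (next c a)) = - z a} ->
  v \in c -> z v != 0 -> (4 %| size c)%N.
Proof.
move=> U st vc zv.
(* A return to [v] after [k] double steps multiplies [z v] by (-1)^k. An odd length p is excluded by
   going round twice (k = p), a length 2 mod 4 by going round once (k = p/2). *)
have odd_no k : odd k -> iter k.*2 (next c) v = v -> False.
  move=> ok e; have := harmonic_iter k st vc; rewrite e -signr_odd ok mulN1r.
  move/eqP; rewrite -addr_eq0 -mulr2n mulrn_eq0 /= => z0.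
  by rewrite z0 in zv.
have per := iter_next_size U vc.
have [op|ep] := boolP (odd (size c)).
  by case: (odd_no _ op); rewrite -addnn iterD !per.
have e2 : size c = (size c)./2.*2 by rewrite even_halfK.
have [oh|eh] := boolP (odd (size c)./2).
  by case: (odd_no _ oh); rewrite -e2.
by rewrite e2 -[X in X.*2]even_halfK // -!muln2 -mulnA dvdn_mull.
Qed.

(** A 2-colouring is a potential for the constant gain -1, for which even cycles have gain 1. *)
Lemma two_coloring (C : numClosedFieldType) (n : nat) (adj : rel 'I_n) :
  simple_graph adj -> (forall c, is_cycle adj c -> ~~ odd (size c)) ->
  exists s : 'I_n -> C, (forall x, s x != 0) /\ (forall a b, adj a b -> s b = - s a).
Proof.
move=> gA ev; have [||s [s0 ps]] := @balanced_potential C n adj (fun _ _ => -1) gA.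
- by move=> x y _; rewrite mulrNN mulr1.
- move=> c /ev; rewrite /cycle_gain big_const_seq count_predT => /negbTE ec.
  by rewrite -[RHS]/((-1) ^+ false) -ec signr_odd -Monoid.iteropE.
exists s; split=> // a b /ps e.
by rewrite -[LHS](mulVKf (s0 a)) -e mulrN1.
Qed.

Lemma is_cycle_neq0 (n : nat) (adj : rel 'I_n) c : is_cycle adj c -> exists x, x \in c.
Proof. by case/and3P; case: c => // x c _ _ _; exists x; rewrite mem_head. Qed.

Lemma is_cycle_del_verts (n : nat) (adj : rel 'I_n) (D : {set 'I_n}) c :
  is_cycle adj c -> {in c, forall x, x \notin D} -> is_cycle (del_verts adj D) c.
Proof.
move=> /and3P[sz U cyc] nD; apply/and3P; split=> //.
apply: cycle_from_next => // a ac.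
by rewrite /del_verts next_cycle // !nD ?mem_next.
Qed.

Lemma is_cycle_del_verts_notin (n : nat) (adj : rel 'I_n) (D : {set 'I_n}) c x :
  is_cycle (del_verts adj D) c -> x \in c -> x \notin D.
Proof. by case/and3P=> _ _ cyc /(next_cycle cyc)/and3P[]. Qed.

Lemma eq_cycle_edge_mem (n : nat) (c1 c2 : seq 'I_n) :
  cycle_edge c1 =2 cycle_edge c2 -> c1 =i c2.
Proof.
suff h (c c' : seq 'I_n) x : cycle_edge c =2 cycle_edge c' -> x \in c -> x \in c'.
  move=> e x; apply/idP/idP; apply: h => // a b; by rewrite e.
move=> e xc; have : cycle_edge c x (next c x) by rewrite /cycle_edge xc eqxx.
by rewrite e => /cycle_edge_in/andP[].
Qed.

(** The colouring is asked for only off [a], so that it can be taken after the cycle has been broken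
    at [a], before the parity of its length is known. *)
Lemma extremal_cycle_out (C : numClosedFieldType) (n : nat) (adj : rel 'I_n)
  (phi : 'I_n -> 'I_n -> C) (z s : 'I_n -> C) c a b :
  extremal adj phi -> is_cycle adj c -> a \in c -> adj a b -> b \notin c ->
  (forall u v, adj u v -> u != a -> v != a -> s v = - s u) -> s b != 0 ->
  harmonic adj z -> z b = 0.
Proof.
move=> ext cc ac aab bc hs sb hz; have [gA _ _] := ext.
have dc := extremal_disjoint_cycles ext.
have [/cycle_edge_in/andP[_ bc']|[_ br]] := cycle_neighbor gA dc cc ac aab.
  by rewrite bc' in bc.
have [_ rk _] := extremal_del_vert ext cc ac.
have [z0 [h0 z0a]] := rank_del_vert_harmonic gA rk.
apply: (bridge_vanish gA aab br hs sb h0) => //.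
by rewrite z0a oner_neq0.
Qed.

Lemma extremal_cycle (C : numClosedFieldType) (n : nat) (adj : rel 'I_n)
  (phi : 'I_n -> 'I_n -> C) c :
  extremal adj phi -> is_cycle adj c -> (4 %| size c)%N /\ cycle_gain phi c != 1.
Proof.
move=> ext0 cc0.
(* Stripping the vertices outside [c] leaves [c] as the only cycle, up to its representation as a
   list. *)
have [D [DQ ext _ only]] := extremal_strip [pred x | x \notin c] ext0.
set adj' := del_verts adj D in ext only.
have cc : is_cycle adj' c.
  by apply: is_cycle_del_verts => // x xc; apply: contraTN xc => /DQ.
have [gA iG rk] := ext; have dc := extremal_disjoint_cycles ext.
have uniq_cycle c' : is_cycle adj' c' -> cycle_edge c' =2 cycle_edge c.
  move=> cc'; apply: dc => //; have [x xc'] := is_cycle_neq0 cc'.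
  apply/pred0Pn; exists x; rewrite /= xc' /=.
  by have := only _ cc' _ xc'; rewrite /= negbK.
have acyc x c' : x \in c -> ~~ is_cycle (del_verts adj' [set x]) c'.
  move=> xc; apply/negP => cc'.
  have cc'' : is_cycle adj' c' by apply: sub_is_cycle cc' => u v _ _ /del_verts_sub.
  have xc' : x \in c' by rewrite (eq_cycle_edge_mem (uniq_cycle _ cc'')).
  by have := is_cycle_del_verts_notin cc' xc'; rewrite inE eqxx.
(* Deleting [a] leaves a forest, which is bipartite whatever the length of [c]. *)
have out (z : 'I_n -> C) a b : harmonic adj' z -> a \in c -> adj' a b -> b \notin c -> z b = 0.
  move=> hz ac aab bc.
  have [|s [s0 hs]] := @two_coloring C n _ (del_verts_simple [set a] gA).
    by move=> c' cc'; have := acyc a c' ac; rewrite cc'.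
  apply: (extremal_cycle_out ext cc ac aab bc _ (s0 b) hz) => u v auv ua va.
  by apply: hs; rewrite /del_verts auv !inE ua va.
have [x xc] := is_cycle_neq0 cc.
have /and3P[_ U _] := cc.
have [_ rkx th] := extremal_del_vert ext cc xc.
split.
  have [z [hz zx]] := rank_del_vert_harmonic gA rkx.
  apply: (harmonic_dvd4 U _ xc (z := z)); last by rewrite zx oner_neq0.
  by move=> a ac; apply: (harmonic_step gA dc cc hz) => // u v; apply: out.
apply/negP => /eqP g1.
case: c cc g1 U uniq_cycle {cc0 DQ only acyc out x xc rkx th dc} => [|x p] //.
move=> cc g1 U uniq_cycle; set y := last x p.
have ce : cycle_edge (x :: p) x y by rewrite /cycle_edge mem_head next_last ?eqxx ?orbT.
have axy := cycle_edge_adj gA cc ce.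
have [d pd] : exists d, potential (del_edge adj' x y) phi d.
  apply: balanced_potential; first exact: del_edge_simple.
    by apply: sub_inv_gain iG; exact: del_edge_sub.
  move=> c' cc'.
  have cc'' : is_cycle adj' c' by apply: sub_is_cycle cc' => u v _ _ /del_edge_sub.
  have := cycle_edge_adj (del_edge_simple x y gA) cc' (etrans (uniq_cycle _ cc'' _ _) ce).
  by rewrite del_edgexx.
(* Gain 1 extends the potential of the forest over the closing edge. Then r(Phi) = r(G), so theta is
   0 although a cycle is present. *)
have pd' := potential_close iG axy pd U (is_cycle_path cc) erefl g1.
have lt := cyclomatic_del_vert gA cc (mem_head _ _).
move: rk lt; rewrite (potential_rank pd') => /eqP.
by rewrite -{1}[\rank _]addn0 eqn_add2l eq_sym muln_eq0 /= => /eqP ->.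
Qed.

(** * Coordinate projections and ranks of principal blocks *)

Definition mxproj (C : numClosedFieldType) (n : nat) (S : {set 'I_n}) : 'M[C]_n :=
  diag_mx (\row_i (i \in S)%:R).
Arguments mxproj C {n} S.

Lemma mxproj_mulmx (C : numClosedFieldType) (m n : nat) (S : {set 'I_m})
  (M : 'M[C]_(m, n)) i j : (mxproj C S *m M) i j = (i \in S)%:R * M i j.
Proof. by rewrite mul_diag_mx !mxE. Qed.

Lemma mulmx_mxproj (C : numClosedFieldType) (m n : nat) (S : {set 'I_n})
  (M : 'M[C]_(m, n)) i j : (M *m mxproj C S) i j = M i j * (j \in S)%:R.
Proof. by rewrite mul_mx_diag !mxE. Qed.

Lemma trmx_mxproj (C : numClosedFieldType) (n : nat) (S : {set 'I_n}) :
  (mxproj C S)^T = mxproj C S.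
Proof. exact: tr_diag_mx. Qed.

Lemma mxprojE (C : numClosedFieldType) (n : nat) (S : {set 'I_n}) i j :
  mxproj C S i j = ((i == j) && (i \in S))%:R.
Proof. by rewrite !mxE; case: (eqVneq i j) => [->|]. Qed.

Lemma mxprojM (C : numClosedFieldType) (n : nat) (S T : {set 'I_n}) :
  mxproj C S *m mxproj C T = mxproj C (S :&: T).
Proof.
apply/matrixP => i j; rewrite mxproj_mulmx !mxprojE inE.
by case: (i \in S); rewrite ?mul1r ?mul0r ?andbF.
Qed.

Lemma mxproj0 (C : numClosedFieldType) (n : nat) : mxproj C (set0 : {set 'I_n}) = 0.
Proof. by apply/matrixP => i j; rewrite mxprojE inE andbF mxE. Qed.

Lemma mxprojC (C : numClosedFieldType) (n : nat) (S : {set 'I_n}) :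
  mxproj C S + mxproj C (~: S) = 1%:M.
Proof.
apply/matrixP => i j; rewrite mxE !mxprojE inE mxE.
by case: (i \in S); case: (i == j); rewrite ?addr0 ?add0r.
Qed.

(** The principal submatrix on [S], padded with zeros so that blocks on different sets can be added
    and multiplied. *)
Definition restr (C : numClosedFieldType) (n : nat) (M : 'M[C]_n) (S : {set 'I_n}) :=
  mxproj C S *m M *m mxproj C S.

Lemma restrE (C : numClosedFieldType) (n : nat) (M : 'M[C]_n) (S : {set 'I_n}) i j :
  restr M S i j = if (i \in S) && (j \in S) then M i j else 0.
Proof.
rewrite mulmx_mxproj mxproj_mulmx.
by case: (i \in S); case: (j \in S); rewrite ?mul1r ?mulr1 ?mul0r ?mulr0.
Qed.

Lemma mxrank_rowsub (F : fieldType) (m m' n : nat) (f : 'I_m' -> 'I_m) (M : 'M[F]_(m, n)) :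
  (\rank (rowsub f M) <= \rank M)%N.
Proof. by apply: mxrankS; apply/row_subP => i; rewrite row_rowsub row_sub. Qed.

Lemma mxrank_mxsub (F : fieldType) (m m' n n' : nat) (f : 'I_m' -> 'I_m)
  (g : 'I_n' -> 'I_n) (M : 'M[F]_(m, n)) : (\rank (mxsub f g M) <= \rank M)%N.
Proof.
rewrite mxsubrc (leq_trans (mxrank_rowsub _ _)) //.
by rewrite -mxrank_tr trmx_mxsub (leq_trans (mxrank_rowsub _ _)) // mxrank_tr.
Qed.

Lemma rank_enum_val (C : numClosedFieldType) (n : nat) (S : {set 'I_n}) (M : 'M[C]_n) :
  \rank (\matrix_(i < #|S|, j < #|S|) M (enum_val i) (enum_val j)) = \rank (restr M S).
Proof.
set M' := \matrix_(i, j) _; apply/eqP; rewrite eqn_leq; apply/andP; split.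
  have -> : M' = mxsub enum_val enum_val (restr M S).
    by apply/matrixP => i j; rewrite mxE [RHS]mxE restrE !enum_valP.
  exact: mxrank_mxsub.
have [S0|[x0 x0S]] := set_0Vmem S.
  suff -> : restr M S = 0 by rewrite mxrank0.
  by apply/matrixP => i j; rewrite restrE S0 inE mxE.
pose r := enum_rank_in x0S.
have -> : restr M S =
    \matrix_(i, j) ((i \in S)%:R * mxsub r r M' i j * (j \in S)%:R).
  apply/matrixP => i j; rewrite restrE !mxE.
  case iS: (i \in S); case jS: (j \in S); rewrite /= ?mul0r ?mulr0 //.
  by rewrite /r !enum_rankK_in // mul1r mulr1.
exact: leq_trans (mxrank_scale_le _ _ _) (mxrank_mxsub _ _ _).
Qed.

Lemma rank_mxproj (C : numClosedFieldType) (n : nat) (S : {set 'I_n}) :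
  \rank (mxproj C S) = #|S|.
Proof.
have -> : mxproj C S = restr 1%:M S by rewrite /restr mulmx1 mxprojM setIid.
rewrite -rank_enum_val -[RHS](mxrank1 C); congr (\rank _).
by apply/matrixP => i j; rewrite !mxE (inj_eq enum_val_inj).
Qed.

(** The hypotheses say that evaluation on [Z] maps the left kernel of [M] injectively into, and
    onto, the functions on [Z]; hence the nullity is [#|Z|]. *)
Lemma rank_evaluation (C : numClosedFieldType) (n : nat) (M : 'M[C]_n) (Z : {set 'I_n}) :
  (forall v : 'rV[C]_n, v *m M = 0 -> {in Z, forall i, v 0 i = 0} -> v = 0) ->
  (forall i, i \in Z -> exists v : 'rV[C]_n,
     [/\ v *m M = 0, v 0 i = 1 & {in Z, forall j, j != i -> v 0 j = 0}]) ->
  (\rank M + #|Z| = n)%N.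
Proof.
move=> inj surj; set K := kermx M; set P := mxproj C Z.
have cap0 : (K :&: kermx P)%MS = 0.
  apply/eqP/rowV0P => v; rewrite sub_capmx => /andP[/sub_kermxP vM /sub_kermxP vP].
  apply: inj => // i iZ; have := congr1 (fun w : 'rV[C]_n => w 0 i) vP.
  by rewrite /P mulmx_mxproj iZ mulr1 mxE.
have rkP : \rank (K *m P) = #|Z|.
  apply/eqP; rewrite -(rank_mxproj C) eqn_leq mxrankM_maxr /=.
  apply: mxrankS; apply/row_subP => i.
  case iZ: (i \in Z); last first.
    suff -> : row i P = 0 by rewrite sub0mx.
    by apply/rowP => j; rewrite mxE mxprojE iZ andbF mxE.
  have [v [vM vi vj]] := surj i iZ.
  have -> : row i P = v *m P.
    apply/rowP => j; rewrite mxE mxprojE iZ andbT mulmx_mxproj.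
    case: (eqVneq i j) => [<-|ij]; first by rewrite vi iZ mulr1.
    by case jZ: (j \in Z); rewrite ?mulr0 // vj ?mul0r // eq_sym.
  by apply: submxMr; apply/sub_kermxP.
have := mxrank_mul_ker K P; rewrite cap0 mxrank0 addn0 rkP => ->.
by rewrite mxrank_ker subnKC // rank_leq_row.
Qed.

Lemma rank_restr_add (C : numClosedFieldType) (n : nat) (X Y : 'M[C]_n) (S T : {set 'I_n}) :
  [disjoint S & T] ->
  \rank (restr X S + restr Y T)%R = (\rank (restr X S) + \rank (restr Y T))%N.
Proof.
move=> dST.
have pST : mxproj C S *m mxproj C T = 0.
  by rewrite mxprojM (disjoint_setI0 dST) mxproj0.
have pTS : mxproj C T *m mxproj C S = 0.
  by rewrite mxprojM setIC (disjoint_setI0 dST) mxproj0.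
set A := restr X S; set B := restr Y T.
have AS : A *m mxproj C S = A by rewrite /A /restr -mulmxA mxprojM setIid.
have BT : B *m mxproj C T = B by rewrite /B /restr -mulmxA mxprojM setIid.
have SA : mxproj C S *m (A + B) = A.
  by rewrite mulmxDr /A /B /restr !mulmxA mxprojM setIid pST !mul0mx addr0.
have TB : mxproj C T *m (A + B) = B.
  by rewrite mulmxDr /A /B /restr !mulmxA pTS !mul0mx add0r mxprojM setIid.
rewrite -mxrank_disjoint_sum; last first.
  apply/eqP/rowV0P => v; rewrite sub_capmx => /andP[/submxP[D ->] /submxP[E e]].
  by rewrite -AS mulmxA e -BT -!mulmxA pTS !mulmx0.
apply/eqP; rewrite eqn_leq; apply/andP; split; apply: mxrankS.
  exact: addmx_sub_adds.
by rewrite addsmx_sub; apply/andP; split; [rewrite -{1}SA|rewrite -{1}TB]; apply: submxMl.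
Qed.

(** * Dual vectors attached to the neighbours of cycles *)

Lemma extremal_coloring (C : numClosedFieldType) (n : nat) (adj : rel 'I_n)
  (phi : 'I_n -> 'I_n -> C) : extremal adj phi ->
  exists s : 'I_n -> C, (forall x, s x != 0) /\ (forall a b, adj a b -> s b = - s a).
Proof.
move=> ext; have [gA _ _] := ext; apply: two_coloring => // c cc.
have [d4 _] := extremal_cycle ext cc; rewrite -dvdn2.
exact: dvdn_trans d4.
Qed.

Lemma eqNr_eq0 (C : numClosedFieldType) (x : C) : (x == - x) = (x == 0).
Proof. by rewrite -addr_eq0 -mulr2n mulrn_eq0. Qed.

Lemma extremal_out (C : numClosedFieldType) (n : nat) (adj : rel 'I_n)
  (phi : 'I_n -> 'I_n -> C) (z : 'I_n -> C) c a b :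
  extremal adj phi -> is_cycle adj c -> a \in c -> adj a b -> b \notin c ->
  harmonic adj z -> z b = 0.
Proof.
move=> ext cc ac aab bc; have [s [s0 hs]] := extremal_coloring ext.
by apply: (extremal_cycle_out ext cc ac aab bc _ (s0 b)) => u v auv _ _; apply: hs.
Qed.

Lemma extremal_cycle_harmonic (C : numClosedFieldType) (n : nat) (adj : rel 'I_n)
  (phi : 'I_n -> 'I_n -> C) c x :
  extremal adj phi -> is_cycle adj c -> x \in c ->
  exists z : 'I_n -> C, harmonic adj z /\ z x = 1.
Proof.
move=> ext cc xc; have [gA _ _] := ext.
have [_ rk _] := extremal_del_vert ext cc xc.
exact: rank_del_vert_harmonic.
Qed.

(** Kernel vectors vanish at [b], while at each vertex on a cycle some kernel vector takes the value
    1. In particular no edge joins two distinct cycles. *)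
Lemma extremal_out_U (C : numClosedFieldType) (n : nat) (adj : rel 'I_n)
  (phi : 'I_n -> 'I_n -> C) c a b :
  extremal adj phi -> is_cycle adj c -> a \in c -> adj a b -> b \notin c ->
  b \in U_verts adj.
Proof.
move=> ext cc ac aab bc; rewrite inE; apply/negP => /asboolP[c' [cc' bc']].
have [z [hz /eqP]] := extremal_cycle_harmonic ext cc' bc'.
by rewrite (extremal_out ext cc ac aab bc hz) eq_sym oner_eq0.
Qed.

Lemma on_cycle_in (n : nat) (adj : rel 'I_n) c x :
  is_cycle adj c -> x \in c -> on_cycle adj x.
Proof. by move=> cc xc; apply/asboolP; exists c. Qed.

Lemma cyc_class_cycle (n : nat) (adj : rel 'I_n) c x :
  disjoint_cycles adj -> is_cycle adj c -> x \in c ->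
  cyc_class adj x = [set y in c].
Proof.
move=> dc cc xc; apply/setP => y; rewrite !inE; apply/orP/idP.
  case=> [/eqP -> //|/asboolP[c' [cc' xc' yc']]].
  rewrite -(eq_cycle_edge_mem (dc _ _ cc' cc _)) //.
  by apply/pred0Pn; exists x; rewrite /= xc' xc.
by move=> yc; right; apply/asboolP; exists c.
Qed.

Lemma cyc_class_U (n : nat) (adj : rel 'I_n) x :
  x \in U_verts adj -> cyc_class adj x = [set x].
Proof.
rewrite inE => nx; apply/setP => y; rewrite !inE.
case: eqVneq => //= _; apply/negP => /asboolP[c [cc xc _]].
by case/negP: nx; apply: on_cycle_in cc xc.
Qed.

(** All neighbours of [v] share the colour [- s v], so filtering by colour keeps the whole equation
    at [v] or none of it. *)
Lemma harmonic_color (C : numClosedFieldType) (n : nat) (adj : rel 'I_n)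
  (z s : 'I_n -> C) t :
  (forall a b, adj a b -> s b = - s a) -> harmonic adj z ->
  harmonic adj (fun u => if s u == t then z u else 0).
Proof.
move=> hs hz v; case: (eqVneq (- s v) t) => [e|ne].
  by rewrite -[RHS](hz v); apply: eq_bigr => u /hs ->; rewrite e eqxx.
by apply: big1 => u /hs ->; rewrite (negbTE ne).
Qed.

Lemma coloring_iter (C : numClosedFieldType) (n : nat) (adj : rel 'I_n) c
  (s : 'I_n -> C) x k :
  is_cycle adj c -> (forall a b, adj a b -> s b = - s a) -> x \in c ->
  s (iter k (next c) x) = (-1) ^+ k * s x.
Proof.
move=> /and3P[_ _ cyc] hs xc; elim: k => [|k IH]; first by rewrite mul1r.
rewrite iterS (hs (iter k (next c) x)); last first.
  by apply: next_cycle; rewrite ?iter_next_mem.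
by rewrite IH exprS mulN1r mulNr.
Qed.

Definition cycle_nbrs (n : nat) (adj : rel 'I_n) : {set 'I_n} :=
  [set y in U_verts adj | [exists a, on_cycle adj a && adj a y]].

Lemma extremal_nbr_vanish (C : numClosedFieldType) (n : nat) (adj : rel 'I_n)
  (phi : 'I_n -> 'I_n -> C) (z : 'I_n -> C) y :
  extremal adj phi -> harmonic adj z -> y \in cycle_nbrs adj -> z y = 0.
Proof.
move=> ext hz; rewrite !inE => /andP[yU /existsP[a /andP[/asboolP[c [cc ac]] aay]]].
apply: (extremal_out ext cc ac aay _ hz).
by apply: contra yU => yc; apply: on_cycle_in cc yc.
Qed.

(** Supplies a kernel vector that vanishes on every cycle but [c]; cut at a bridge leaving [c], it
    becomes a vector supported on [U_verts]. *)
Lemma extremal_localized (C : numClosedFieldType) (n : nat) (adj : rel 'I_n)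
  (phi : 'I_n -> 'I_n -> C) c a :
  extremal adj phi -> is_cycle adj c -> a \in c ->
  exists z : 'I_n -> C, [/\ harmonic adj z, z a = 1, z (next c a) = 0 &
    forall u, on_cycle adj u -> u \notin c -> z u = 0].
Proof.
move=> ext cc ac; have [s [s0 hs]] := extremal_coloring ext.
have [gA _ _] := ext; have dc := extremal_disjoint_cycles ext.
have [D [DQ extD ker only]] := extremal_strip [pred v | (v \notin c) && (s v == s a)] ext.
(* [D] hits every other cycle that has a vertex coloured like [a] at such a
   vertex, so the part of [z1] of that colour vanishes on all other cycles. *)
have cD : {in c, forall x, x \notin D}.
  by move=> x xc; apply/negP => /DQ /andP[]; rewrite xc.
have ccD := is_cycle_del_verts cc cD.
have [z0 [h0 z0a]] := extremal_cycle_harmonic extD ccD ac.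
pose z1 u := if u \in D then 0 else z0 u.
have h1 : harmonic adj z1.
  apply: ker => [v|x xD]; last by rewrite /z1 xD.
  rewrite -[RHS](h0 v); apply: eq_bigr => u /and3P[_ _ /negbTE uD].
  by rewrite /z1 uD.
pose z2 u := if s u == s a then z1 u else 0.
have h2 : harmonic adj z2 by apply: harmonic_color.
have /and3P[_ U cyc] := cc.
exists z2; split=> //.
- by rewrite /z2 eqxx /z1 (negbTE (cD _ ac)).
- by rewrite /z2 (hs a) ?next_cycle // eq_sym eqNr_eq0 (negbTE (s0 a)).
move=> u /asboolP[c' [cc' uc']] uc; rewrite {1}/z2; case: eqP => // su.
have [t tc' tD] : exists2 t, t \in c' & t \in D.
  have [/hasP[t tc' tD]|/hasPn nD] := boolP (has [in D] c'); first by exists t.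
  have /(only c') := is_cycle_del_verts cc' nD.
  by move=> /(_ u uc'); rewrite /= uc su eqxx.
have /andP[_ /eqP st] := DQ _ tD.
have /and3P[_ U' _] := cc'.
have := uc'; rewrite -(fconnect_cycle (cycle_next U') tc') => /iter_findex.
move: (findex _ _ _) => m em.
have z2t : z2 t = 0 by rewrite /z2 /z1 tD; case: ifP.
have z2u : z1 u = z2 u by rewrite /z2 su eqxx.
have st2 : {in c', forall a, z2 (next c' (next c' a)) = - z2 a}.
  move=> v vc'; apply: (harmonic_step gA dc cc' h2 _ vc') => a1 b1 ac1 ab1 bc1.
  exact: (extremal_out ext cc' ac1 ab1 bc1 h2).
(* Since [t] and [u] share a colour, the number [m] of steps between them is even, and double steps
   carry the zero at [t] to [u]. *)
have := coloring_iter m cc' hs tc'; rewrite em su st -signr_odd.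
case om: (odd m); rewrite ?mul1r ?mulN1r.
  by move/eqP; rewrite eqNr_eq0 (negbTE (s0 a)).
by move=> _; rewrite z2u -em -(even_halfK (negbT om)) harmonic_iter // z2t mulr0.
Qed.

(** The witness is [- z] on the branch [B] beyond the bridge [ay]. Inside [B] the cut loses only the
    term [z a = 1] of the equation at [y]; outside, only [a] has a neighbour in [B], namely [y],
    where [z] vanishes. *)
Lemma extremal_dual (C : numClosedFieldType) (n : nat) (adj : rel 'I_n)
  (phi : 'I_n -> 'I_n -> C) y :
  extremal adj phi -> y \in cycle_nbrs adj ->
  exists w : 'I_n -> C, [/\ forall v, \sum_(u | adj v u) w u = (v == y)%:R,
     {in cycle_nbrs adj, forall u, w u = 0} & {in ~: U_verts adj, forall u, w u = 0}].
Proof.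
move=> ext yN; have [gA _ _] := ext; have dc := extremal_disjoint_cycles ext.
have := yN; rewrite !inE => /andP[yU /existsP[a /andP[/asboolP[c [cc ac]] aay]]].
have yc : y \notin c by apply: contra yU => yc; apply: on_cycle_in cc yc.
have nce : ~~ cycle_edge c a y by apply: contra yc => /cycle_edge_in/andP[].
have [ce|[_ br]] := cycle_neighbor gA dc cc ac aay; first by rewrite ce in nce.
have [z [hz za _ zO]] := extremal_localized ext cc ac.
pose B := connect (del_edge adj a y) y.
pose w u := if B u then - z u else 0.
have zy : z y = 0 by apply: extremal_nbr_vanish ext hz yN.
have wE v : \sum_(u | adj v u) w u = - \sum_(u | adj v u && B u) z u.
  rewrite -sumrN big_mkcondr; apply: eq_bigr => u _; rewrite /w; by case: (B u).
exists w; split=> [v|u uN|u uO]; rewrite ?wE.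
- case Bv: (B v).
    have := bridge_sum gA aay br z Bv; rewrite (hz v) za => /esym/eqP.
    rewrite addr_eq0 => /eqP ->; rewrite opprK.
    by case: eqP.
  have -> : (v == y) = false by apply: contraFF Bv => /eqP ->; exact: connect0.
  rewrite big1 ?oppr0 // => u /andP[avu Bu].
  have [->|[]] := eqVneq u y; first by rewrite zy.
  rewrite gA.1 in avu.
  have [-> _] := bridge_boundary gA br Bu avu (negbT Bv).
  by rewrite eqxx.
- by rewrite /w (extremal_nbr_vanish ext hz uN) oppr0; case: ifP.
move: uO; rewrite !inE negbK => uO; rewrite /w; case: ifP => // Bu.
(* A vertex of [c] in [B] would connect [a] to [y] along [c], without the bridge. *)
have [uc|uc] := boolP (u \in c); last by rewrite zO ?oppr0.
have /and3P[_ _ cyc'] := is_cycle_del_edge cc nce.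
have cau := connect_cycle cyc' ac uc.
case/negP: br; apply: connect_trans cau _.
by rewrite (sym_connect_sym (del_edge_simple a y gA).1).
Qed.

(** * Ranks of the cycle blocks, and their decoupling from the graph on [U_verts] *)

Lemma restr_adj_mx (C : numClosedFieldType) (n : nat) (adj : rel 'I_n) (S : {set 'I_n}) :
  restr (adj_mx C adj) S = adj_mx C (del_verts adj (~: S)).
Proof.
apply/matrixP => i j; rewrite restrE !mxE /del_verts !inE !negbK.
by case: (i \in S); case: (j \in S); rewrite ?andbT ?andbF.
Qed.

(** The kernel of the cycle is parametrised by the values at two consecutive vertices [x] and [y].
    The vertices off [c], isolated in [adj'], join them in [Z] because the matrix keeps size [n]. *)
Lemma extremal_cycle_rank (C : numClosedFieldType) (n : nat) (adj : rel 'I_n)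
  (phi : 'I_n -> 'I_n -> C) c :
  extremal adj phi -> is_cycle adj c ->
  \rank (restr (adj_mx C adj) [set x in c]) = (size c - 2)%N.
Proof.
move=> ext cc; have [gA _ _] := ext; have dc := extremal_disjoint_cycles ext.
have /and3P[sz U cyc] := cc; have [x xc] := is_cycle_neq0 cc.
set S := [set x in c]; rewrite restr_adj_mx; set adj' := del_verts adj (~: S).
have gA' : simple_graph adj' := del_verts_simple _ gA.
have dc' : disjoint_cycles adj' by apply: sub_disjoint_cycles dc; exact: del_verts_sub.
have cc' : is_cycle adj' c by apply: is_cycle_del_verts => // u uc; rewrite !inE uc.
set y := next c x; have yc : y \in c by rewrite mem_next.
have axy : adj x y by apply: next_cycle.
have yx : y != x by apply: contraTneq axy => ->; rewrite gA.2.
set Z := ~: S :|: [set x; y].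
have cS : #|S| = size c by rewrite cardsE; apply/card_uniqP.
have dZ : [disjoint ~: S & [set x; y]].
  rewrite disjoint_sym disjoints_subset setCK; apply/subsetP => u.
  by rewrite !inE => /orP[/eqP ->|/eqP ->].
have cZ : (#|Z| + size c = n + 2)%N.
  rewrite cardsU (disjoint_setI0 dZ) cards0 subn0 cards2 eq_sym yx -cS addnAC.
  by rewrite [(#|~: S| + _)%N]addnC cardsC card_ord.
(* A kernel vector with value 1 at [u] is filtered by the colour of [u], which kills it at [u'], and
   then cut to [c]; the cut is harmless because kernel vectors vanish at neighbours off [c]. *)
have loc u u' : u \in c -> u' \in c -> (u' == next c u) || (u == next c u') ->
   exists v : 'rV[C]_n,
     [/\ v *m adj_mx C adj' = 0, v 0 u = 1, v 0 u' = 0 & {in ~: S, forall j, v 0 j = 0}].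
  move=> uc uc' adjuu'; have [s [s0 hs]] := extremal_coloring ext.
  have [z [hz zu]] := extremal_cycle_harmonic ext cc uc.
  pose z2 v := if s v == s u then z v else 0.
  have h2 : harmonic adj z2 by apply: harmonic_color.
  pose z3 v := if v \in c then z2 v else 0.
  exists (\row_v z3 v); split.
  - apply/harmonicP => // v; have [vc|vc] := boolP (v \in c); last first.
      by apply: big1 => w /and3P[_]; rewrite !inE vc.
    rewrite -[RHS](h2 v) [LHS]big_mkcond [RHS]big_mkcond; apply: eq_bigr => w _.
    rewrite /adj' /del_verts /z3 !inE !negbK vc.
    case avw: (adj v w) => //=; case wc: (w \in c) => //.
    by rewrite (extremal_out ext cc vc avw (negbT wc) h2).
  - by rewrite mxE /z3 uc /z2 eqxx.
  - rewrite mxE /z3 uc' /z2; have -> : s u' = - s u.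
      case/orP: adjuu' => /eqP e; first by apply: hs; rewrite e next_cycle.
      by rewrite (hs u' u) ?opprK // e next_cycle.
    by rewrite eq_sym eqNr_eq0 (negbTE (s0 u)).
  - by move=> j; rewrite !inE mxE /z3 => /negbTE ->.
suff : (\rank (adj_mx C adj') + #|Z| = n)%N.
  have arith (r k p m : nat) : (r + k = m -> k + p = m + 2 -> r = p - 2)%N by lia.
  by move/arith; apply.
apply: rank_evaluation => [v vM vZ|i].
  have hv : harmonic adj' (v 0).
    by apply/harmonicP => //; rewrite -[RHS]vM; congr (_ *m _); apply/rowP => i; rewrite mxE.
  have st u : u \in c -> v 0 (next c (next c u)) = - v 0 u.
    move=> uc; apply: (harmonic_step gA' dc' cc' hv _ uc) => a b _ /and3P[_ _].
    by rewrite !inE negbK => ->.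
  apply/rowP => i; rewrite mxE; have [ic|ic] := boolP (i \in c); last first.
    by apply: vZ; rewrite !inE ic.
  (* Two consecutive zeros propagate around the cycle. *)
  pose P u := (v 0 u == 0) && (v 0 (next c u) == 0).
  suff /andP[/eqP] : P i by [].
  apply: (next_closed_subset U xc) ic => /=.
    by rewrite /P !vZ ?eqxx // !inE eqxx ?orbT.
  by move=> u uc /andP[/eqP e0 e1]; rewrite /P e1 st // e0 oppr0 eqxx.
rewrite in_setU in_set2 => /or3P[iS|/eqP ->|/eqP ->].
- exists (delta_mx 0 i); split.
  + apply/rowP => j; rewrite mxE (bigD1 i) //= big1 ?addr0 => [|k ki]; last first.
      by rewrite [delta_mx _ _ _ _]mxE (negbTE ki) andbF mul0r.
    by rewrite !mxE !eqxx mul1r /adj' /del_verts iS andbF.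
  + by rewrite mxE !eqxx.
  + by move=> j _ ji; rewrite mxE (negbTE ji) andbF.
- have [|v [vM vx vy vS]] := loc x y xc yc; first by rewrite eqxx.
  exists v; split=> // j; rewrite in_setU in_set2 => /or3P[/vS //|/eqP ->|/eqP -> //].
  by rewrite eqxx.
- have [|v [vM vy vx vS]] := loc y x yc xc; first by rewrite eqxx orbT.
  exists v; split=> // j; rewrite in_setU in_set2 => /or3P[/vS //|/eqP -> //|/eqP ->].
  by rewrite eqxx.
Qed.

Lemma extremal_dual_mx (C : numClosedFieldType) (n : nat) (adj : rel 'I_n)
  (phi : 'I_n -> 'I_n -> C) : extremal adj phi ->
  exists W : 'M[C]_n, [/\ adj_mx C adj *m W = mxproj C (cycle_nbrs adj),
     mxproj C (cycle_nbrs adj) *m W = 0 & mxproj C (U_verts adj) *m W = W].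
Proof.
move=> ext; set N := cycle_nbrs adj.
have /choice[w wP] : forall y, exists w : 'I_n -> C, y \in N ->
    [/\ forall v, \sum_(u | adj v u) w u = (v == y)%:R,
        {in N, forall u, w u = 0} & {in ~: U_verts adj, forall u, w u = 0}].
  move=> y; case yN: (y \in N); last by exists (fun _ => 0).
  by have [w hw] := extremal_dual ext yN; exists w.
exists (\matrix_(u, y) if y \in N then w y u else 0); split; apply/matrixP => v y.
- rewrite mxE mxprojE.
  have -> : \sum_j adj_mx C adj v j * (\matrix_(u, y0) (if y0 \in N then w y0 u else 0)) j y =
            \sum_(u | adj v u) (if y \in N then w y u else 0).
    rewrite [RHS]big_mkcond; apply: eq_bigr => u _; rewrite !mxE.
    by case: (adj v u); rewrite ?mul1r ?mul0r.
  case yN: (y \in N); first by have [-> _ _] := wP y yN; case: eqVneq => // ->; rewrite yN.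
  by rewrite big1 //; case: eqVneq => // ->; rewrite yN.
- rewrite mxproj_mulmx !mxE; case yN: (y \in N); last by rewrite mulr0.
  have [_ wN _] := wP y yN.
  by case vN: (v \in N); rewrite ?mul0r // wN ?mulr0.
- rewrite mxproj_mulmx !mxE; case yN: (y \in N); last by rewrite mulr0.
  have [_ _ wU] := wP y yN.
  case vU: (v \in U_verts adj); rewrite ?mul1r ?mul0r // wU //.
  by rewrite in_setC vU.
Qed.

(* [W] solves [A w = e_y] for every [y] in [N] and vanishes on [N], so the cross
   terms [L], [L^T] are absorbed by a congruence. *)
Lemma restr_congruence (C : numClosedFieldType) (n : nat) (A W L : 'M[C]_n)
  (U N : {set 'I_n}) :
  A^T = A -> N \subset U -> A *m W = mxproj C N -> mxproj C N *m W = 0 ->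
  mxproj C U *m W = W -> mxproj C N *m L = L ->
  (1%:M + W *m L)^T *m restr A U *m (1%:M + W *m L) = restr A U + L + L^T.
Proof.
move=> sA NU AW NW UW NL.
have RW : restr A U *m W = mxproj C N.
  by rewrite /restr -!mulmxA UW AW mxprojM (setIidPr NU).
have sR : (restr A U)^T = restr A U.
  by rewrite /restr !trmx_mul sA !trmx_mxproj mulmxA.
have WR : W^T *m restr A U = mxproj C N by rewrite -sR -trmx_mul RW trmx_mxproj.
have WL : W^T *m L = 0.
  by rewrite -NL mulmxA -[mxproj C N]trmx_mxproj -trmx_mul NW trmx0 mul0mx.
have LN : L^T *m mxproj C N = L^T by rewrite -{2}NL trmx_mul trmx_mxproj.
have MT : (1%:M + W *m L)^T = 1%:M + L^T *m W^T by rewrite linearD /= trmx1 trmx_mul.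
rewrite -mulmxA mulmxDr mulmx1 mulmxA RW NL MT.
by rewrite mulmxDl mul1mx mulmxDr -!mulmxA WR WL LN mulmx0 addr0.
Qed.

Lemma rank_restr_bigcup (C : numClosedFieldType) (n : nat) (adj : rel 'I_n)
  (F : 'I_n -> {set 'I_n}) (r : seq 'I_n) :
  uniq r ->
  {in r &, forall x y a b, x != y -> a \in F x -> b \in F y ->
     [/\ a != b, ~~ adj a b & ~~ adj b a]} ->
  \rank (restr (adj_mx C adj) (\bigcup_(x <- r) F x)) =
  (\sum_(x <- r) \rank (restr (adj_mx C adj) (F x)))%N.
Proof.
elim: r => [|x r IH] /=.
  by rewrite !big_nil /restr mxproj0 mulmx0 mxrank0.
move=> /andP[xr Ur] sep; rewrite !big_cons -IH //; last first.
  by move=> u v ur vr; apply: sep; rewrite inE ?ur ?vr orbT.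
set S := F x; set T := \bigcup_(y <- r) F y.
have sepT a b : a \in S -> b \in T -> [/\ a != b, ~~ adj a b & ~~ adj b a].
  move=> aS bT; have [y yr bF] : exists2 y, y \in r & b \in F y.
    apply/hasP; move: bT; rewrite /T; elim: (r) => [|y r' IHr]; rewrite ?big_nil ?inE //.
    by rewrite big_cons inE /= => /orP[->|/IHr ->] //; rewrite orbT.
  apply: (sep x y) => //; rewrite ?mem_head ?inE ?yr ?orbT //.
  by apply: contraNneq xr => ->.
rewrite -rank_restr_add; last first.
  apply/pred0P => u /=; apply/negP => /andP[uS uT].
  by have [] := sepT _ _ uS uT; rewrite eqxx.
congr (\rank _); apply/matrixP => i j; rewrite [RHS]mxE !restrE !in_setU.
case iS: (i \in S); case jS: (j \in S); case iT: (i \in T); case jT: (j \in T);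
  rewrite /= ?addr0 ?add0r //; rewrite ?mxE.
all: try by have [] := sepT _ _ iS iT; rewrite eqxx.
all: try by have [] := sepT _ _ jS jT; rewrite eqxx.
all: try by have [_ /negbTE -> _] := sepT _ _ iS jT.
all: by have [_ _ /negbTE ->] := sepT _ _ jS iT.
Qed.

(** Both vertices are the least one on the same cycle. *)
Lemma TG_verts_class_inj (n : nat) (adj : rel 'I_n) x y :
  disjoint_cycles adj -> x \in TG_verts adj -> y \in TG_verts adj ->
  on_cycle adj x -> on_cycle adj y -> ~~ [disjoint cyc_class adj x & cyc_class adj y] ->
  x = y.
Proof.
move=> dc; rewrite !inE => /forall_inP mx /forall_inP my.
move=> /asboolP[c [cc xc]] /asboolP[c' [cc' yc']] /pred0Pn[z /andP[/=]].
rewrite (cyc_class_cycle dc cc xc) (cyc_class_cycle dc cc' yc') !inE => zc zc'.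
have e : c =i c'.
  by apply: eq_cycle_edge_mem; apply: dc => //; apply/pred0Pn; exists z; rewrite /= zc zc'.
apply: val_inj; apply/eqP; rewrite eqn_leq mx ?my //.
  by rewrite (cyc_class_cycle dc cc' yc') inE -e.
by rewrite (cyc_class_cycle dc cc xc) inE e.
Qed.

Lemma TG_verts_repr (n : nat) (adj : rel 'I_n) c x :
  disjoint_cycles adj -> is_cycle adj c -> x \in c ->
  exists2 t, t \in TG_verts adj & t \in c.
Proof.
move=> dc cc xc.
have [t tc tmin] := arg_minnP (fun i : 'I_n => val i) xc.
exists t; last by [].
by rewrite inE; apply/forall_inP => y; rewrite (cyc_class_cycle dc cc tc) inE => /tmin.
Qed.

Lemma cyc_class_nonadjacent (C : numClosedFieldType) (n : nat) (adj : rel 'I_n)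
  (phi : 'I_n -> 'I_n -> C) x y a b :
  extremal adj phi -> x \in TG_verts adj -> y \in TG_verts adj ->
  on_cycle adj x -> on_cycle adj y -> x != y ->
  a \in cyc_class adj x -> b \in cyc_class adj y -> a != b /\ ~~ adj a b.
Proof.
move=> ext xT yT ox oy xy ax by_; have dc := extremal_disjoint_cycles ext.
have nd : [disjoint cyc_class adj x & cyc_class adj y].
  by apply: contraNT xy => nd; rewrite (TG_verts_class_inj dc xT yT ox oy nd).
have [/asboolP[c [cc xc]] /asboolP[c' [cc' yc']]] := (ox, oy).
have bc : b \notin c.
  apply/negP => bc; move/pred0P/(_ b): nd; rewrite /= by_ andbT.
  by rewrite (cyc_class_cycle dc cc xc) inE bc.
move: ax by_; rewrite (cyc_class_cycle dc cc xc) (cyc_class_cycle dc cc' yc') !inE.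
move=> ac bc'; split; first by apply: contraNneq bc => <-.
apply/negP => aab; have := extremal_out_U ext cc ac aab bc.
by rewrite inE (on_cycle_in cc' bc').
Qed.

(** Distinct cycles are disjoint and not adjacent, so this part of the matrix is block diagonal,
    with one block per representative in [TG_verts]. *)
Lemma extremal_rank_cycles (C : numClosedFieldType) (n : nat) (adj : rel 'I_n)
  (phi : 'I_n -> 'I_n -> C) : extremal adj phi ->
  \rank (restr (adj_mx C adj) (~: U_verts adj)) =
  (\sum_(x in TG_verts adj | on_cycle adj x) (#|cyc_class adj x| - 2))%N.
Proof.
move=> ext; have dc := extremal_disjoint_cycles ext; have [gA _ _] := ext.
set R := [set x in TG_verts adj | on_cycle adj x].
have -> : ~: U_verts adj = \bigcup_(x <- enum R) cyc_class adj x.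
  apply/setP => u; rewrite !inE negbK big_enum /=; apply/idP/bigcupP.
    move=> /asboolP[c [cc uc]]; have [t tT tc] := TG_verts_repr dc cc uc.
    exists t; first by rewrite inE tT; apply: on_cycle_in cc tc.
    by rewrite (cyc_class_cycle dc cc tc) inE.
  move=> [t]; rewrite inE => /andP[_ /asboolP[c [cc tc]]].
  by rewrite (cyc_class_cycle dc cc tc) inE; apply: on_cycle_in.
rewrite rank_restr_bigcup ?enum_uniq //; last first.
  move=> x y; rewrite !mem_enum ![_ \in R]in_set => /andP[xT ox] /andP[yT oy] a b xy ax by_.
  have [ab nab] := cyc_class_nonadjacent ext xT yT ox oy xy ax by_.
  by rewrite gA.1 in nab *; split=> //; rewrite gA.1.
rewrite big_enum /=; apply: eq_big => [x|x]; first by rewrite inE.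
rewrite inE => /andP[_ /asboolP[c [cc xc]]].
have /and3P[_ U _] := cc.
rewrite (cyc_class_cycle dc cc xc) (extremal_cycle_rank ext cc) cardsE.
by rewrite (card_uniqP U).
Qed.

(** In block form [A] is [G + L + L^T + O], with [L] the edges from [U] to the cycles. The
    congruence by [M] produces [L] and [L^T] from [G] and fixes [O], so [A] has the rank of
    [G + O]. *)
Lemma extremal_rank_split (C : numClosedFieldType) (n : nat) (adj : rel 'I_n)
  (phi : 'I_n -> 'I_n -> C) : extremal adj phi ->
  \rank (adj_mx C adj) =
  (\rank (restr (adj_mx C adj) (U_verts adj)) +
   \rank (restr (adj_mx C adj) (~: U_verts adj)))%N.
Proof.
move=> ext; have [gA _ _] := ext; have sA := adj_mx_sym C gA.
have [W [AW NW UW]] := extremal_dual_mx ext.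
set A := adj_mx C adj in AW sA *; set U := U_verts adj in UW *.
set N := cycle_nbrs adj in AW NW.
have NU : N \subset U by apply/subsetP => u; rewrite inE => /andP[].
pose L := mxproj C U *m A *m mxproj C (~: U).
have NL : mxproj C N *m L = L.
  apply/matrixP => y x; rewrite mxproj_mulmx mulmx_mxproj mxproj_mulmx mxE.
  case yN: (y \in N); rewrite ?mul1r // mul0r.
  case yU: (y \in U); rewrite ?mul0r //; case xU: (x \in ~: U); rewrite ?mulr0 //.
  case ayx: (adj y x); rewrite ?mulr0 ?mul0r //.
  move: yN; rewrite inE yU /= => /negbT; rewrite negb_exists => /forallP/(_ x).
  by move: xU; rewrite !inE negbK => ->; rewrite gA.1 ayx.
have [OU UO] : mxproj C (~: U) *m mxproj C U = 0 /\ mxproj C U *m mxproj C (~: U) = 0.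
  by rewrite !mxprojM setICr setIC setICr mxproj0.
(* [W] has its nonzero rows in [U], whereas [L] and [O] have their nonzero columns outside [U]. *)
have LW : L *m W = 0 by rewrite /L -{1}UW -!mulmxA [_ *m (_ *m W)]mulmxA OU mul0mx !mulmx0.
have OW : restr A (~: U) *m W = 0.
  by rewrite /restr -{1}UW -!mulmxA [_ *m (_ *m W)]mulmxA OU mul0mx !mulmx0.
set M := 1%:M + W *m L; set O := restr A (~: U); set G := restr A U.
have sO : O^T = O by rewrite /O /restr !trmx_mul sA !trmx_mxproj mulmxA.
have OM : O *m M = O by rewrite mulmxDr mulmx1 mulmxA OW mul0mx addr0.
have MO : M^T *m O = O by rewrite -{1}sO -trmx_mul OM sO.
have EA : A = M^T *m (G + O) *m M.
  rewrite mulmxDr mulmxDl MO OM (restr_congruence sA NU AW NW UW NL) -/G.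
  rewrite -[LHS]mul1mx -(mxprojC C U) -[LHS]mulmx1 -(mxprojC C U).
  have -> : L^T = mxproj C (~: U) *m A *m mxproj C U.
    by rewrite /L !trmx_mul sA !trmx_mxproj mulmxA.
  by rewrite mulmxDl mulmxDr !mulmxDl -/G -/L -/O addrACA !addrA.
(* As [L *m W = 0], the matrix [W *m L] squares to zero. *)
have MV : M *m (1%:M - W *m L) = 1%:M.
  rewrite mulmxDl mul1mx mulmxBr mulmx1 -mulmxA [L *m _]mulmxA LW mul0mx mulmx0 subr0.
  by rewrite subrK.
have uM : M \in unitmx by have [] := mulmx1_unit MV.
have dUO : [disjoint U & ~: U] by rewrite disjoints_subset setCK.
rewrite -(rank_restr_add _ _ dUO) -/G -/O {1}EA mxrankMfree ?row_free_unit //.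
by rewrite eqmxMfull // row_full_unit unitmx_tr.
Qed.

Lemma U_verts_sub_TG (n : nat) (adj : rel 'I_n) : U_verts adj \subset TG_verts adj.
Proof.
apply/subsetP => x xU; rewrite inE; apply/forall_inP => y.
by rewrite (cyc_class_U xU) inE => /eqP ->.
Qed.

(** The same congruence applies with contracted cycles: no two of them are adjacent in T_G, so no
    cycle block remains and the rank is at most that of [restr A U]. Conversely [restr A U] is a
    principal block of the matrix of T_G. *)
Lemma extremal_rank_TG (C : numClosedFieldType) (n : nat) (adj : rel 'I_n)
  (phi : 'I_n -> 'I_n -> C) : extremal adj phi ->
  \rank (TG_mx C adj) = \rank (restr (adj_mx C adj) (U_verts adj)).
Proof.
move=> ext; have [gA _ _] := ext; have sA := adj_mx_sym C gA.
have dc := extremal_disjoint_cycles ext.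
have [W [AW NW UW]] := extremal_dual_mx ext.
set A := adj_mx C adj in AW sA *; set U := U_verts adj in UW *.
set N := cycle_nbrs adj in AW NW.
have NU : N \subset U by apply/subsetP => u; rewrite inE => /andP[].
pose TM : 'M[C]_n := \matrix_(x, y) (TG_adj adj x y)%:R.
have -> : \rank (TG_mx C adj) = \rank (restr TM (TG_verts adj)).
  rewrite -rank_enum_val; congr (\rank _); by apply/matrixP => i j; rewrite !mxE.
(* Edges of T_G between [U] and the contracted cycles, each cycle standing at its representative. *)
pose L : 'M[C]_n := \matrix_(y, x) ([&& y \in U, x \in TG_verts adj, x \notin U &
  [exists a in cyc_class adj x, adj a y]])%:R.
have NL : mxproj C N *m L = L.
  apply/matrixP => y x; rewrite mxproj_mulmx mxE.
  case: and4P => [[yU xT xU /existsP[a /andP[ax aay]]]|_]; last by rewrite mulr0.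
  suff -> : y \in N by rewrite mul1r.
  rewrite inE yU; apply/existsP; exists a; rewrite aay andbT.
  move: xU; rewrite inE negbK => /asboolP[c [cc xc]].
  move: ax; rewrite (cyc_class_cycle dc cc xc) inE; exact: on_cycle_in.
have TU x y : x \in U -> TG_adj adj x y = (x != y) && [exists b in cyc_class adj y, adj b x].
  move=> xU; rewrite /TG_adj (cyc_class_U xU); congr (_ && _).
  apply/existsP/existsP => [[a /andP[]]|[b /andP[bc abx]]].
    rewrite inE => /eqP -> /existsP[b /andP[bc axb]].
    by exists b; rewrite bc gA.1.
  exists x; rewrite inE eqxx; apply/existsP; exists b.
  by rewrite bc gA.1.
have Tsym x y : TG_adj adj x y = TG_adj adj y x.
  rewrite /TG_adj eq_sym; congr (_ && _).
  apply/existsP/existsP => -[a /andP[ac /existsP[b /andP[bc aab]]]];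
  by exists b; rewrite bc; apply/existsP; exists a; rewrite ac gA.1.
have ET : restr TM (TG_verts adj) = restr A U + L + L^T.
  have sUT : {subset U <= TG_verts adj} by apply/subsetP; exact: U_verts_sub_TG.
  apply/matrixP => x y; rewrite [RHS]mxE [X in _ = X + _]mxE !restrE !mxE.
  have [xU|xU] := boolP (x \in U); have [yU|yU] := boolP (y \in U);
    rewrite ?(sUT _ xU) ?(sUT _ yU) /= ?andbF ?addr0 ?add0r.
  - rewrite TU // (cyc_class_U yU); congr (_%:R).
    have -> : [exists b in [set y], adj b x] = adj y x.
      apply/existsP/idP => [[b]|ayx]; first by rewrite inE => /andP[/eqP ->].
      by exists y; rewrite inE eqxx.
    rewrite gA.1; case: eqVneq => //= ->; by rewrite gA.2.
  - case: (y \in TG_verts adj) => //=; rewrite TU //.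
    by case: eqVneq => // e; rewrite -e xU in yU.
  - case: (x \in TG_verts adj) => //=; rewrite Tsym TU //.
    by case: eqVneq => // e; rewrite -e yU in xU.
  - case: andP => // -[xT yT]; case Txy: (TG_adj adj x y) => //.
    have ox : on_cycle adj x by move: xU; rewrite inE negbK.
    have oy : on_cycle adj y by move: yU; rewrite inE negbK.
    case/andP: Txy => xy /existsP[a /andP[ax /existsP[b /andP[by_ aab]]]].
    by have [_] := cyc_class_nonadjacent ext xT yT ox oy xy ax by_; rewrite aab.
apply/eqP; rewrite eqn_leq; apply/andP; split.
  rewrite ET -(restr_congruence sA NU AW NW UW NL).
  exact: leq_trans (mxrankM_maxl _ _) (mxrankM_maxr _ _).
have -> : restr A U = restr (restr TM (TG_verts adj)) U.
  rewrite ET; apply/matrixP => x y; rewrite !restrE.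
  case: (boolP (x \in U)) => xU; case: (boolP (y \in U)) => yU //=.
  by rewrite [RHS]mxE [X in _ = X + _]mxE restrE !mxE xU yU /= ?andbF !addr0.
exact: leq_trans (mxrankM_maxl _ _) (mxrankM_maxr _ _).
Qed.

Lemma rank_GammaG (C : numClosedFieldType) (n : nat) (adj : rel 'I_n) :
  \rank (GammaG_mx C adj) = \rank (restr (adj_mx C adj) (U_verts adj)).
Proof.
by rewrite -rank_enum_val; congr (\rank _); apply/matrixP => i j; rewrite !mxE.
Qed.

Theorem theorem4p7 (C : numClosedFieldType) (n : nat) (adj : rel 'I_n)
  (phi : 'I_n -> 'I_n -> C) :
  simple_graph adj -> unit_gain adj phi ->
  \rank (gain_adj_mx adj phi) = (\rank (adj_mx C adj) + 2 * cyclomatic adj)%N ->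
  [/\ (forall c1 c2, is_cycle adj c1 -> is_cycle adj c2 ->
         ~~ [disjoint c1 & c2] -> cycle_edge c1 =2 cycle_edge c2),
      (forall c, is_cycle adj c -> (4 %| size c)%N /\ typeB phi c) &
      (\rank (adj_mx C adj) =
         (\rank (TG_mx C adj) +
          \sum_(x in TG_verts adj | on_cycle adj x) (#|cyc_class adj x| - 2))%N
       /\ \rank (TG_mx C adj) = \rank (GammaG_mx C adj))].
Proof.
move=> gA uG rk; have ext : extremal adj phi by split=> //; apply: unit_gain_inv.
have ET := extremal_rank_TG ext.
split.
- exact: extremal_disjoint_cycles ext.
- move=> c cc; have [d4 g1] := extremal_cycle ext cc; split=> //.
  have ev : ~~ odd (size c) by rewrite -dvdn2; apply: dvdn_trans d4.
  (* Half the length is even, so Type B amounts to a gain different from 1. *)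
  rewrite /typeB ev /=; suff -> : (-1) ^+ (size c)./2 = 1 :> C by [].
  rewrite -signr_odd; suff -> : odd (size c)./2 = false by [].
  have [k ->] := dvdnP d4; by rewrite -[4%N]/(2 * 2)%N mulnA muln2 doubleK muln2 odd_double.
- by rewrite rank_GammaG ET (extremal_rank_split ext) (extremal_rank_cycles ext).
Qed.
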